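(* Let $\mathbb{K}$ be a field and let $I\subseteq\mathbb{K}[x_1,\ldots,x_n]$ be a support-two monomial ideal which is non-minimal, i.e. $\mu(I)>\mu(\sqrt{I})$, and such that every variable $x_1,\ldots,x_n$ divides some minimal monomial generator of $I$. Then $I$ has a linear resolution if and only if, up to a permutation of the variables, $I$ is one of the following ideals: (1) $n=2$ and $I=(x_1^{a_1-i}x_2^{b_1+i}\mid 0\le i\le k)$, for integers $k\ge1$, $a_1>k$, $b_1\ge 1$; (2) $n\ge3$ and $I=(x_1^{a_1-i}x_2^{b_1+i}\mid 0\le i\le k)+(x_2^{b_1+k}x_j\mid 3\le j\le n)$, for integers $k\ge1$, $b_1\ge 1$ and $a_1=k+1$; (3) $I=(x_1^{k+1-i}x_2^{i}\mid 1\le i\le k)+(x_jx_1^{k}\mid 3\le j\le s)+(x_jx_2^{k}\mid s+1\le j\le n)$, for integers $k\ge2$ and $3\le s<n$; (4) $n\ge3$ and $I=(x_1^{k+1-i}x_2^{i}\mid 1\le i\le k)+(x_jx_1^{k}\mid 3\le j\le n)+(x_jx_2^{k}\mid 3\le j\le n)$, for an integer $k\ge2$; (5) $I=(x_1^{k+1-i}x_2^{i}\mid 1\le i\le k)+(x_jx_1^{k}\mid 3\le j\le n)+(x_jx_2^{k}\mid p+1\le j\le n)$, for integers $k\ge2$ and $3\le p<n$; (6) $I=(x_1^{k+1-i}x_2^{i}\mid 1\le i\le k)+(x_jx_1^{k}\mid 3\le j\le s)+(x_jx_2^{k}\mid p+1\le j\le n)$, for integers $k\ge2$ and $3\le p<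s<n$.
   Context: The polynomial ring has the standard grading. For a monomial ideal $I$, $\mathcal{G}(I)$ is its minimal set of monomial generators and $\mu(I)=|\mathcal{G}(I)|$. A monomial ideal $I$ is a support-two monomial ideal if every $u\in\mathcal{G}(I)$ is divisible by exactly two variables. A nonzero graded ideal $I$ has a linear resolution if $\operatorname{reg}(I)=\alpha(I)$, where $\operatorname{reg}$ is Castelnuovo-Mumford regularity and $\alpha(I)$ is the minimum degree of a nonzero homogeneous element of $I$. *)

(* Defs.v *)
From mathcomp Require Import all_boot all_order all_fingroup all_algebra.
From mathcomp Require Export mpoly.

Set Implicit Arguments.
Unset Strict Implicit.
Unset Printing Implicit Defensive.

Import GRing.Theory.
Local Open Scope ring_scope.

Section Ideals.
Context {K : fieldType} {n : nat}.
Implicit Types (I J : {mpoly K[n]} -> Prop) (p : {mpoly K[n]}).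

Definition same_ideal I J : Prop := forall p, I p <-> J p.

Definition ideal_span (S : {mpoly K[n]} -> Prop) p : Prop :=
  exists r (c g : 'I_r -> {mpoly K[n]}),
    (forall i, S (g i)) /\ p = \sum_(i < r) c i * g i.

Definition monomial_span (S : 'X_{1..n} -> Prop) : {mpoly K[n]} -> Prop :=
  ideal_span (fun q => exists2 m, S m & q = 'X_[m]).

Definition radical I p : Prop := exists e : nat, I (p ^+ e).

(* [G] enumerates, without repetition, the set G(I) of minimal monomial
   generators of [I].  Monomial ideals are finitely generated, so [I] is a
   monomial ideal iff such a [G] exists; it is then unique up to reordering. *)
Definition is_mingens I (G : seq 'X_{1..n}) : Prop :=
  [/\ uniq G,
      same_ideal I (monomial_span (fun m => m \in G)) &
      forall G' : seq 'X_{1..n}, {subset G' <= G} ->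
        same_ideal I (monomial_span (fun m => m \in G')) -> {subset G <= G'}].

(* mu(I) = k, for a monomial ideal I *)
Definition is_mu I (k : nat) : Prop := exists2 G, is_mingens I G & size G = k.

Definition support_two I : Prop :=
  exists2 G, is_mingens I G &
    forall u, u \in G -> #|[set i : 'I_n | (0 < u i)%N]| = 2%N.

Definition non_minimal I : Prop :=
  exists k l, [/\ is_mu I k, is_mu (radical I) l & (l < k)%N].

Definition all_variables_occur I : Prop :=
  exists2 G, is_mingens I G &
    forall i : 'I_n, exists2 u, u \in G & (0 < u i)%N.

End Ideals.

Section Regularity.
Context {K : fieldType} {n : nat}.
Implicit Types (I : {mpoly K[n]} -> Prop).

(* The data of a complex  ... -> F_2 -> F_1 -> F_0 -> S  of graded free modules
   over S = K[x_1,...,x_n], where F_i = (+)_j S(- fdeg i j) is the module of row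
   vectors of length [frank i], and maps act by right multiplication.  Shifts of
   minimal resolutions of ideals of S are never negative, so they are taken in
   [nat]. *)
Record free_complex := FreeComplex {
  frank : nat -> nat;
  fdeg : forall i, 'I_(frank i) -> nat;
  fdiff : forall i, 'M[{mpoly K[n]}]_(frank i.+1, frank i);
  faug : 'cV[{mpoly K[n]}]_(frank 0)
}.

(* The entry (j, k) of [fdiff i] is homogeneous of degree
   fdeg i.+1 j - fdeg i k in the integers (and 0 if this is negative). *)
Definition graded_complex (F : free_complex) : Prop :=
  (forall j, faug F j 0 \is (fdeg j).-homog) /\
  (forall i j k, {in msupp (fdiff F i j k),
     forall m, (mdeg m + fdeg k)%N = fdeg j}).

Definition resolves (F : free_complex) I : Prop :=
  [/\ forall p, I p <-> exists v : 'rV_(frank F 0), p = (v *m faug F) 0 0,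
      forall v : 'rV_(frank F 0),
        v *m faug F = 0 <-> exists w, v = w *m fdiff F 0 &
      forall i (v : 'rV_(frank F i.+1)),
        v *m fdiff F i = 0 <-> exists w, v = w *m fdiff F i.+1].

(* All differentials vanish modulo the ideal (x_1,...,x_n). *)
Definition minimal_complex (F : free_complex) : Prop :=
  forall i j k, (fdiff F i j k)@_0%MM = 0.

Definition minimal_graded_free_resolution I (F : free_complex) : Prop :=
  [/\ graded_complex F, resolves F I & minimal_complex F].

Definition betti (F : free_complex) (i d : nat) : nat :=
  #|[set j : 'I_(frank F i) | fdeg j == d]|.

(* reg(I) = r, i.e. r = max { d - i | beta_{i,d}(I) <> 0 }; the graded Betti
   numbers do not depend on the minimal resolution. *)
Definition is_reg I (r : nat) : Prop :=
  exists F, [/\ minimal_graded_free_resolution I F,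
    exists i, betti F i (i + r) != 0%N &
    forall i d, betti F i d != 0%N -> (d <= i + r)%N].

Definition is_alpha I (al : nat) : Prop :=
  (exists p, [/\ I p, p != 0 & p \is al.-homog]) /\
  (forall d p, I p -> p != 0 -> p \is d.-homog -> (al <= d)%N).

Definition has_linear_resolution I : Prop :=
  exists2 r, is_reg I r & is_alpha I r.

End Regularity.

Section Families.
Context {n : nat}.

(* The variable x_j, with 1 <= j <= n; variables are numbered from 1 here,
   whereas 'I_n starts at 0.  (This is the monomial 1 for j out of range.) *)
Definition xvar (j : nat) : 'X_{1..n} := [multinom (i.+1 == j : nat) | i < n].

(* (x_1^(a-i) x_2^(b+i) | 0 <= i <= k), for k <= a *)
Definition shifted_powers (a b k : nat) (m : 'X_{1..n}) : Prop :=
  exists2 i, (i <= k)%N & m = (xvar 1 *+ (a - i) + xvar 2 *+ (b + i))%MM.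

(* (x_1^(k+1-i) x_2^i | 1 <= i <= k) *)
Definition inner_powers (k : nat) (m : 'X_{1..n}) : Prop :=
  exists2 i, (1 <= i <= k)%N & m = (xvar 1 *+ (k + 1 - i) + xvar 2 *+ i)%MM.

(* (x_j w | lo <= j <= hi) *)
Definition star (w : 'X_{1..n}) (lo hi : nat) (m : 'X_{1..n}) : Prop :=
  exists2 j, (lo <= j <= hi)%N & m = (xvar j + w)%MM.

Definition mon_union (S T : 'X_{1..n} -> Prop) (m : 'X_{1..n}) : Prop := S m \/ T m.

End Families.

Section Classification.
Context {K : fieldType} {n : nat}.
Implicit Types (J : {mpoly K[n]} -> Prop).

Definition case1 J : Prop := n = 2%N /\
  exists k a b : nat, [/\ (1 <= k)%N, (k < a)%N, (1 <= b)%N &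
    same_ideal J (monomial_span (shifted_powers a b k))].

Definition case2 J : Prop := (3 <= n)%N /\
  exists k a b : nat, [/\ (1 <= k)%N, (1 <= b)%N, a = (k + 1)%N &
    same_ideal J (monomial_span
      (mon_union (shifted_powers a b k) (star (xvar 2 *+ (b + k))%MM 3 n)))].

Definition case3 J : Prop :=
  exists k s : nat, [/\ (2 <= k)%N, (3 <= s)%N, (s < n)%N &
    same_ideal J (monomial_span
      (mon_union (inner_powers k)
        (mon_union (star (xvar 1 *+ k)%MM 3 s) (star (xvar 2 *+ k)%MM (s + 1) n))))].

Definition case4 J : Prop := (3 <= n)%N /\
  exists2 k : nat, (2 <= k)%N &
    same_ideal J (monomial_span
      (mon_union (inner_powers k)
        (mon_union (star (xvar 1 *+ k)%MM 3 n) (star (xvar 2 *+ k)%MM 3 n)))).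

Definition case5 J : Prop :=
  exists k p : nat, [/\ (2 <= k)%N, (3 <= p)%N, (p < n)%N &
    same_ideal J (monomial_span
      (mon_union (inner_powers k)
        (mon_union (star (xvar 1 *+ k)%MM 3 n) (star (xvar 2 *+ k)%MM (p + 1) n))))].

Definition case6 J : Prop :=
  exists k p s : nat, [/\ (2 <= k)%N, (3 <= p)%N, (p < s)%N, (s < n)%N &
    same_ideal J (monomial_span
      (mon_union (inner_powers k)
        (mon_union (star (xvar 1 *+ k)%MM 3 s) (star (xvar 2 *+ k)%MM (p + 1) n))))].

(* The inverse image of an ideal under the automorphism of K[x_1,...,x_n]
   permuting the variables by [s]. *)
Definition permute_ideal (s : 'S_n) J : {mpoly K[n]} -> Prop :=
  fun p => J (msym s p).

End Classification.

(* Main.v *)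
Require Import Defs.
From HB Require Import structures.
From mathcomp Require Import all_boot all_order all_fingroup all_algebra.
From mathcomp Require Import ring zify.
From Stdlib Require Import ClassicalEpsilon.

(** Over a linear resolution concentrated in the shifts d + i, the first syzygies
    of the generators are linear, so any two generators are joined by a path of
    generators dividing their lcm and changing one variable at a time; similarly
    linear second syzygies forbid the "hexagon" of the six generators
    x_i^2 x_j of degree 3 in three variables.  Non-minimality provides an edge
    {a, b} carrying two generators.  A path can leave this edge only at
    x_a^(d-1) x_b or x_a x_b^(d-1), which forces every other generator to be
    x_j x_a^(d-1) or x_j x_b^(d-1).  Conversely such ideals have linear
    quotients, and iterated mapping cones build a linear resolution, starting
    with the Koszul complexes of the colon ideals. *)

Set Implicit Arguments.
Unset Strict Implicit.
Unset Printing Implicit Defensive.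

Import GRing.Theory.
Local Open Scope ring_scope.

(** * Monomials and monomial ideals *)

(** Linear first syzygies alone do not suffice. The six monomials x_i^2 x_j in three variables form
    a cycle in which any two are joined by a path inside their lcm, yet x_a x_b x_c lies outside the
    ideal they generate while its multiples by x_a, x_b and x_c lie inside; this produces a second
    syzygy in multidegree (2,2,2), of degree 6 instead of 5. The argument on paths leaves only this
    situation in degree 3 open, and there alone second syzygies enter.

    The constants of the families come from the ends of the edge. A star x_j x_a^(d-1) is reached
    only through x_a^(d-1) x_b, and a star x_j x_b^(d-1) only through x_a x_b^(d-1). So each kind of
    star fixes one end of the interval of exponents on the edge, and both kinds force the full
    interval, which is why a_1 and b_1 disappear from the last four families. If A and B are the
    sets of leaves at a and b, what remains is which of A \ B, A meet B and B \ A are empty: eight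
    patterns, which become six up to the exchange of a and b. *)

Section MonomialPart.
Context {K : fieldType} {n : nat}.
Implicit Types (p q : {mpoly K[n]}) (P Q : pred 'X_{1..n}).

(** Truncation serves three main purposes: homogeneous components in [homog_lift], restriction of
    the augmentation to some generators in [linres_connected], and setting variables to zero in
    [linres_colon3]. *)
Definition mpart P p : {mpoly K[n]} :=
  \sum_(m <- msupp p | P m) p@_m *: 'X_[m].

Lemma mcoeff_part P p m : (mpart P p)@_m = if P m then p@_m else 0.
Proof.
rewrite /mpart raddf_sum /=.
under eq_bigr => k _ do rewrite mcoeffZ mcoeffX.
have [m_in|m_notin] := boolP (m \in msupp p); last first.
  rewrite big_seq_cond big1 ?(memN_msupp_eq0 m_notin) ?if_same // => k.
  case/andP=> k_in _; case: eqP => [km|_]; last by rewrite mulr0.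
  by rewrite -km k_in in m_notin.
rewrite big_mkcond (bigD1_seq m) //= big1 ?addr0 => [|k /negbTE ->].
  by rewrite eqxx mulr1.
by rewrite mulr0 if_same.
Qed.

Lemma mpart_is_linear P : linear (mpart P).
Proof.
move=> c p q; apply/mpolyP => m; rewrite mcoeffD mcoeffZ !mcoeff_part.
by case: ifP; rewrite ?mcoeffD ?mcoeffZ ?mulr0 ?addr0.
Qed.

HB.instance Definition _ P :=
  GRing.isLinear.Build K {mpoly K[n]} {mpoly K[n]} _ (mpart P) (mpart_is_linear P).

Lemma mpart_id P p : {in msupp p, forall m, P m} -> mpart P p = p.
Proof.
move=> Pp; apply/mpolyP => m; rewrite mcoeff_part.
case: ifP => // /negP Pm; case: (boolP (m \in msupp p)) => [/Pp //|].
by move/memN_msupp_eq0 => ->.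
Qed.

Lemma msupp_part P p m : (m \in msupp (mpart P p)) = P m && (m \in msupp p).
Proof. by rewrite !mcoeff_msupp mcoeff_part; case: (P m); rewrite ?eqxx. Qed.

(** Three predicates, compared only on the supports, cover both uses: with one factor homogeneous, a
    degree condition on the product is a degree condition on the other factor; for monomials in
    given variables, all three predicates coincide. *)
Lemma mpartM P Q R p q :
    (forall k l, k \in msupp p -> l \in msupp q -> P (k + l)%MM = Q k && R l) ->
  mpart P (p * q) = mpart Q p * mpart R q.
Proof.
move=> PQR; have E m a b : m = (a + b)%MM -> (if P m then p@_a * q@_b else 0) =
    (mpart Q p)@_a * (mpart R q)@_b.
  move=> ->; rewrite !mcoeff_part.
  have [a_in|/memN_msupp_eq0 ->] := boolP (a \in msupp p);
    last by rewrite !if_same !mul0r if_same.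
  have [b_in|/memN_msupp_eq0 ->] := boolP (b \in msupp q);
    last by rewrite !if_same !mulr0 if_same.
  by rewrite PQR //; case: (Q a); case: (R b); rewrite ?mul0r ?mulr0.
apply/mpolyP => m; rewrite mcoeff_part !mcoeffM.
under [RHS]eq_bigr => k /eqP /E <- do [].
by case: ifP => // _; rewrite big1.
Qed.

Lemma mcoeffXM p k m : (k <= m)%MM -> ('X_[k] * p)@_m = p@_(m - k).
Proof.
by move=> km; rewrite -{1}(submK km) addmC -(commr_mpolyX k p) mcoeffMX.
Qed.

Lemma msuppXM p k m : m \in msupp ('X_[k] * p) ->
  (k <= m)%MM /\ (m - k)%MM \in msupp p.
Proof.
move=> m_in; have km : (k <= m)%MM.
  move/msuppM_le: (m_in) => /allpairsP [[a b] /= []].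
  by rewrite msuppX inE => /eqP -> _ ->; rewrite lem_addr.
by move: m_in; rewrite !mcoeff_msupp mcoeffXM.
Qed.

Lemma mpoly_dividesX k p : {in msupp p, forall m, (k <= m)%MM} ->
  exists q, p = 'X_[k] * q.
Proof.
move=> kp; exists (\sum_(m <- msupp p) p@_m *: 'X_[m - k]).
rewrite {1}[p]mpolyE mulr_sumr big_seq [RHS]big_seq.
by apply: eq_bigr => m /kp km; rewrite -scalerAr -mpolyXD addmC submK.
Qed.

Lemma mpoly_split p k : exists q r, p = 'X_[k] * q + r /\
  {in msupp r, forall m, (m \in msupp p) && ~~ (k <= m)%MM}.
Proof.
pose P := [pred m | (k <= m)%MM].
have /mpoly_dividesX [q qE] : {in msupp (mpart P p), forall m, (k <= m)%MM}.
  by move=> m; rewrite msupp_part => /andP[].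
exists q, (mpart (predC P) p); split; last first.
  by move=> m; rewrite msupp_part /= andbC.
rewrite -qE; apply/mpolyP => m; rewrite mcoeffD !mcoeff_part /=.
by case: lem; rewrite ?addr0 ?add0r.
Qed.

Lemma coprimeX_divides (k l : 'X_{1..n}) p q : (forall i, k i = 0%N \/ l i = 0%N) ->
  'X_[k] * p = 'X_[l] * q -> exists c, p = 'X_[l] * c /\ q = 'X_[k] * c.
Proof.
move=> kl pq; have [c pE] : exists c, p = 'X_[l] * c.
  apply: mpoly_dividesX => m m_in.
  have : (m + k)%MM \in msupp ('X_[l] * q).
    by rewrite -pq mcoeff_msupp mcoeffXM ?lem_addl // addmK -mcoeff_msupp.
  case/msuppXM => /mnm_lepP lm _; apply/mnm_lepP => i.
  by move: (lm i); rewrite mnmDE; case: (kl i) => ->; rewrite ?addn0.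
exists c; split => //.
have X0 : 'X_[l] != 0 :> {mpoly K[n]} by rewrite -msize_poly_eq0 msizeX.
by apply: (mulfI X0); rewrite -pq pE; ring.
Qed.

End MonomialPart.

Section MonomialIdeals.
Context {K : fieldType} {n : nat}.
Implicit Types (I J : {mpoly K[n]} -> Prop) (p q : {mpoly K[n]}).
Implicit Types (S T : 'X_{1..n} -> Prop).

Lemma ideal_spanD (S : {mpoly K[n]} -> Prop) p q :
  ideal_span S p -> ideal_span S q -> ideal_span S (p + q).
Proof.
case=> r1 [c1 [g1 [S1 ->]]] [r2 [c2 [g2 [S2 ->]]]].
exists (r1 + r2)%N, (fun i => match split i with inl j => c1 j | inr j => c2 j end),
  (fun i => match split i with inl j => g1 j | inr j => g2 j end); split.
  by move=> i; case: split.
rewrite big_split_ord /=; congr (_ + _); apply: eq_bigr => i _.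
  by have -> : split (lshift r2 i) = inl i := unsplitK (inl i).
by have -> : split (rshift r1 i) = inr i := unsplitK (inr i).
Qed.

Lemma ideal_span0 (S : {mpoly K[n]} -> Prop) : ideal_span S 0.
Proof.
exists 0%N, (fun=> 0), (fun=> 0); split; first by case.
by rewrite big_ord0.
Qed.

Lemma ideal_span_mul (S : {mpoly K[n]} -> Prop) p q :
  S q -> ideal_span S (p * q).
Proof.
by move=> Sq; exists 1%N, (fun=> p), (fun=> q); split; rewrite ?big_ord1.
Qed.

Lemma monomial_spanP S p :
  monomial_span S p <-> {in msupp p, forall m, exists2 u, S u & (u <= m)%MM}.
Proof.
split.
  case=> r [c [g [Sg ->]]] m; rewrite mcoeff_msupp raddf_sum /= => nz.
  have [i nzi] : exists i, (c i * g i)@_m != 0.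
    apply/existsP; apply: contraR nz; rewrite negb_exists => /forallP z.
    by apply/eqP; apply: big1 => i _; apply/eqP; move: (z i); rewrite negbK.
  case: (Sg i) => u Su gE; exists u => //.
  by move: nzi; rewrite gE mulrC -mcoeff_msupp => /msuppXM [].
move=> Sp; rewrite [p]mpolyE big_seq.
apply: (big_ind (monomial_span S)); [exact: ideal_span0|exact: ideal_spanD|].
move=> m /Sp [u Su um]; rewrite -(submK um) mpolyXD scalerAl.
by apply: ideal_span_mul; exists u.
Qed.

Lemma monomial_spanX S m : monomial_span S ('X_[m] : {mpoly K[n]}) <->
  exists2 u, S u & (u <= m)%MM.
Proof.
rewrite monomial_spanP; split; first by apply; rewrite msuppX inE.
by move=> Sm k; rewrite msuppX inE => /eqP ->.
Qed.

Lemma monomial_span_mono S T p :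
  (forall m, S m -> T m) -> monomial_span S p -> monomial_span T p.
Proof.
by move=> ST /monomial_spanP Sp; apply/monomial_spanP => m /Sp [u /ST]; exists u.
Qed.

Lemma eq_monomial_span S T : (forall m, S m <-> T m) ->
  same_ideal (monomial_span S : {mpoly K[n]} -> Prop) (monomial_span T).
Proof. by move=> ST p; split; apply: monomial_span_mono => m /ST. Qed.

End MonomialIdeals.

(** * Linear resolutions *)

Section LinearStrand.
Context {K : fieldType} {n : nat}.
Implicit Types (I J : {mpoly K[n]} -> Prop) (p q : {mpoly K[n]}).

(** Minimality is automatic here, as entries of degree 1 have no constant term. The zero ideal
    satisfies this for every [d], with all ranks 0: it starts the inductions on linear quotients,
    and it is why the return to [has_linear_resolution] asks for a nonzero element. *)
Definition linres I (d : nat) : Prop :=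
  exists (r : nat -> nat) (A : forall i, 'M[{mpoly K[n]}]_(r i.+1, r i))
    (a : 'cV[{mpoly K[n]}]_(r 0%N)),
    [/\ forall j, a j 0 \is d.-homog,
        forall i j k, A i j k \is 1.-homog &
        resolves (FreeComplex (fun i _ => (d + i)%N) A a) I].

Lemma linres_mem I d p : linres I d -> I p ->
  {in msupp p, forall m, (d <= mdeg m)%N}.
Proof.
case=> r [A [a [a_homog _ [memI _ _]]]] /memI /= [v ->] m.
rewrite mxE => /msupp_sum_le /flatten_mapP [j _].
case/msuppM_le/allpairsP => -[k l] /= [_ l_in ->].
by rewrite mdegD (dhomogP _ _ _ (a_homog j) l l_in) leq_addl.
Qed.

Lemma linres_has_linear_resolution I d :
  linres I d -> (exists2 p, I p & p != 0) -> has_linear_resolution I.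
Proof.
move=> linI [p Ip p0]; exists d; last split.
- case: linI => r [A [a [a_homog A_homog resF]]].
  exists (FreeComplex (fun i _ => (d + i)%N) A a); split.
  + split=> //; last first.
      move=> i j k /=; apply: (dhomog_nemf_coeff (A_homog i j k)).
      by rewrite mf0.
    split=> [j|i j k m m_in] /=; first by rewrite addn0.
    by rewrite (dhomogP _ _ _ (A_homog i j k) m m_in); lia.
  + exists 0%N; apply/eqP => betti0.
    case: resF => memI _ _; case/memI: Ip => /= v pE.
    case/eqP: p0; rewrite pE mxE big1 // => j _.
    by have /eqP := cards0_eq betti0 => /eqP/setP/(_ j); rewrite !inE /=; lia.
  + move=> i e; rewrite -lt0n card_gt0 => /set0Pn [j].
    by rewrite inE /= => /eqP <-; rewrite addnC.
- case: (linI) => r [A [a [a_homog A_homog [memI _ _]]]].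
  case/memI: (Ip) => /= v pE.
  have [j aj0] : exists j, a j 0 != 0.
    apply/existsP; apply: contraNT p0; rewrite negb_exists => /forallP z.
    apply/eqP; rewrite pE mxE big1 // => j _.
    by move: (z j); rewrite negbK => /eqP ->; rewrite mulr0.
  exists (a j 0); split=> //; apply/memI => /=; exists (delta_mx 0 j).
  by rewrite -rowE mxE.
- move=> e q Iq q0 q_homog; have m_in := mlead_supp q0.
  by rewrite -(dhomogP _ _ _ q_homog _ m_in); apply: (linres_mem linI Iq).
Qed.

(* Minimality forbids zero rows, so each differential raises degrees by at
   least one; the regularity bound then forces the shifts to be [d + i]. *)
Lemma has_linear_resolution_linres I :
  has_linear_resolution I -> exists d, linres I d.
Proof.
case=> d [[r fd A a] [[[/= a_homog A_homog] resF minF] _ deg_le]] [_ al_le].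
case: (resF) => /= memI exact0 exactS; exists d.
(* A basis vector is never a boundary: by minimality the entries of a boundary have no constant
   term. *)
have no_delta i (j : 'I_(r i)) (w : 'rV_(r i.+1)) : delta_mx 0 j != w *m A i.
  apply/eqP => /matrixP /(_ 0 j); rewrite !mxE !eqxx /=.
  move/(congr1 (mcoeff 0%MM)); rewrite mcoeff1 eqxx raddf_sum /= big1 => [|k _].
    by move/eqP; rewrite oner_eq0.
  by rewrite rmorphM /= minF mulr0.
have fdE i j : fd i j = (d + i)%N.
  apply/eqP; rewrite eqn_leq; apply/andP; split.
    rewrite addnC; apply: deg_le; rewrite -lt0n card_gt0.
    by apply/set0Pn; exists j; rewrite inE.
  elim: i j => [|i IHi] j.
    rewrite addn0; apply: al_le (a_homog j).
      by apply/memI; exists (delta_mx 0 j); rewrite -rowE mxE.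
    apply/eqP => aj0; have /exact0 [w /eqP] : (delta_mx 0 j : 'rV_(r 0%N)) *m a = 0.
      by apply/matrixP => x y; rewrite -rowE !mxE !ord1.
    by apply/negP.
  (* A zero row would make a basis vector a cycle, hence a boundary. *)
  have [k Ajk] : exists k, A i j k != 0.
    apply/existsP; apply: contraT; rewrite negb_exists => /forallP z.
    have /exactS [w /eqP] : (delta_mx 0 j : 'rV_(r i.+1)) *m A i = 0.
      by apply/matrixP => x y; rewrite -rowE !mxE; move: (z y) => /negPn/eqP.
    by move/negP: (no_delta _ j w).
  have m_in := mlead_supp Ajk; have := A_homog _ _ _ _ m_in.
  have : mdeg (mlead (A i j k)) != 0%N.
    apply/eqP => /eqP; rewrite mdeg_eq0 => /eqP m0.
    by move: m_in; rewrite m0 mcoeff_msupp minF eqxx.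
  by have := IHi k; lia.
exists r, A, a; split => //.
  by move=> j; have := a_homog j; rewrite fdE addn0.
by move=> i j k; apply/dhomogP => m /A_homog /=; rewrite !fdE => mE;
  apply/eqP; rewrite -(eqn_add2r (d + i)) mE addnS add1n.
Qed.

End LinearStrand.

(** Each comparison map of the mapping cone is built from the previous one, in a type that depends
    on the index and by a mere existence proof; this assembles them into one sequence. *)
Lemma dependent_choice (X : nat -> Type) (R : forall i, X i -> X i.+1 -> Prop)
    (x0 : X 0%N) : (forall i x, exists y, R i x y) ->
  exists2 f : forall i, X i, f 0%N = x0 & forall i, R i (f i) (f i.+1).
Proof.
move=> total.
pose next i x := constructive_indefinite_description _ (total i x).
exists (nat_rect X x0 (fun i x => sval (next i x))) => // i /=.
exact: svalP (next i _).
Qed.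

(** * Mapping cones that preserve linearity *)

Section MappingCone.
Context {K : fieldType} {n : nat}.
Implicit Types (I J L : {mpoly K[n]} -> Prop) (p q u : {mpoly K[n]}).

Lemma rows_factor m s t (V : 'M[{mpoly K[n]}]_(m, t)) (M : 'M_(s, t)) :
  (forall i, exists w : 'rV_s, row i V = w *m M) -> exists W, V = W *m M.
Proof.
case/fin_all_exists => w wE; exists (\matrix_(i, j) w i 0 j).
apply/row_matrixP => i; rewrite wE row_mul; congr (_ *m _).
by apply/rowP => j; rewrite !mxE.
Qed.

Lemma mulmx_homog m s t (V : 'M[{mpoly K[n]}]_(m, s)) (M : 'M_(s, t)) k e :
  (forall i j, V i j \is k.-homog) -> (forall i j, M i j \is e.-homog) ->
  forall i j, (V *m M) i j \is (k + e).-homog.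
Proof.
by move=> Vk Me i j; rewrite mxE; apply: rpred_sum => l _; apply: dhomogM.
Qed.

(** Exactness yields lifts without control on degrees. Cutting every entry down to degree [k]
    repairs this: [M] is homogeneous and the product already has the right degree, so the discarded
    terms contribute nothing. *)
Lemma homog_lift m s t (V : 'M[{mpoly K[n]}]_(m, s)) (M : 'M_(s, t)) k e :
    (forall i j, M i j \is e.-homog) ->
    (forall i j, (V *m M) i j \is (k + e).-homog) ->
  exists2 W : 'M_(m, s), (forall i j, W i j \is k.-homog) & W *m M = V *m M.
Proof.
move=> Me VMke; pose P l := [pred x : 'X_{1..n} | mdeg x == l].
exists (\matrix_(i, j) mpart (P k) (V i j)).
  move=> i j; rewrite mxE; apply/dhomogP => x.
  by rewrite msupp_part => /andP[xk _]; apply/eqP.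
apply/matrixP => i j; transitivity (mpart (P (k + e)%N) ((V *m M) i j)).
  rewrite !mxE linear_sum /=; apply: eq_bigr => l _.
  rewrite mxE (mpartM (Q := P k) (R := predT)) ?(@mpart_id _ _ predT) //.
  move=> x y _ y_in /=; rewrite mdegD (dhomogP _ _ _ (Me l j) y y_in).
  by rewrite andbT eqn_add2r.
by apply: mpart_id => x x_in; apply/eqP/(dhomogP _ _ _ (VMke i j) x x_in).
Qed.

Lemma mulmx_rows0 m s t (V : 'M[{mpoly K[n]}]_(m, s)) (M : 'M_(s, t)) i :
  V *m M = 0 -> row i V *m M = 0.
Proof. by move=> VM0; rewrite -row_mul VM0 row0. Qed.

(* The comparison maps [phi i] lift multiplication by [u] from the resolution
   of S/L to that of S/J; the resolution of J + (u) is their mapping cone. *)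
Lemma linres_cone J L d u : linres J d -> linres L 1 -> u \is d.-homog ->
    (forall p, J (p * u) <-> L p) ->
  linres (fun p => exists2 q, J q & exists c, p = q + c * u) d.
Proof.
case=> r [A [a [a_homog A_homog [memJ Aex0 AexS]]]].
case=> s [B [b [b_homog B_homog [memL Bex0 BexS]]]] u_homog JL.
(* Prepending a module of rank 1 turns the resolution of L into that of S/L, with shifts 0, 1, 2,
   ...; since u has degree d, the cone then has the shifts d + i. *)
rewrite /= in memJ Aex0 AexS memL Bex0 BexS.
pose s' i := if i is i'.+1 then s i' else 1%N.
pose B' i : 'M[{mpoly K[n]}]_(s' i.+1, s' i) :=
  match i with 0%N => b | i'.+1 => B i' end.
have B'_homog i j k : B' i j k \is 1.-homog.
  by case: i j k => [|i] j k //=; rewrite (ord1 k).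
have B'ex i (v : 'rV_(s' i.+1)) : v *m B' i = 0 <-> exists w, v = w *m B' i.+1.
  by case: i v => [|i] v /=; [apply: Bex0|apply: BexS].
have B'0 i : B' i.+1 *m B' i = 0.
  apply/row_matrixP => j; rewrite row_mul row0; apply/B'ex.
  by exists (delta_mx 0 j); rewrite -rowE.
(* The factorization through [psi] is carried along because it is the input of the next step: a
   homogeneous version of [psi] becomes the next map. *)
pose X i := {phi : 'M[{mpoly K[n]}]_(s' i.+1, r i) |
  (forall j k, phi j k \is 1.-homog) /\ exists psi, B' i.+1 *m phi = psi *m A i}.
have [x0 x0E] : exists x0 : X 0%N, sval x0 *m a = B' 0%N *m u%:M.
  have [psi psiE] : exists psi, b *m u%:M = psi *m a.
    apply: rows_factor => j; have /memJ [w wE] : J (b j 0 * u).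
      apply/JL/memL; exists (delta_mx 0 j); rewrite -rowE mxE //.
    exists w; apply/rowP => k; rewrite !ord1 -wE !mxE big_ord1 !mxE eqxx.
    by rewrite mulr1n.
  have u_hom (i j : 'I_1) : (u%:M : 'M_1) i j \is d.-homog.
    by rewrite !ord1 mxE mulr1n.
  have a_hom i (j : 'I_1) : a i j \is d.-homog by rewrite ord1.
  have [phi phi_homog phiE] : exists2 phi : 'M_(s 0%N, r 0%N),
      (forall i j, phi i j \is 1.-homog) & phi *m a = psi *m a.
    apply: homog_lift a_hom _ => i j; rewrite -psiE.
    by apply: mulmx_homog u_hom i j => i j; apply: (B'_homog 0%N).
  suff h : (forall j k, phi j k \is 1.-homog) /\
      exists psi, B' 1%N *m phi = psi *m A 0%N.
    by exists (exist _ phi h); rewrite /= phiE -psiE.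
  split=> //; apply: rows_factor => j; apply/Aex0; apply: mulmx_rows0.
  by rewrite -mulmxA phiE -psiE mulmxA (B'0 0%N) mul0mx.
pose R i (x : X i) (y : X i.+1) := sval y *m A i = B' i.+1 *m sval x.
have [|f f0 fE] := dependent_choice (R := R) x0.
  move=> i [phi [phi_homog [psi psiE]]].
  have [phi' phi'_homog phi'E] : exists2 phi' : 'M_(s i.+1, r i.+1),
      (forall i j, phi' i j \is 1.-homog) & phi' *m A i = psi *m A i.
    apply: homog_lift (A_homog i) _ => j k; rewrite -psiE.
    exact: mulmx_homog (B'_homog i.+1) phi_homog j k.
  suff h : (forall j k, phi' j k \is 1.-homog) /\
      exists psi', B' i.+2 *m phi' = psi' *m A i.+1.
    by exists (exist _ phi' h); rewrite /R /= phi'E.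
  split=> //; apply: rows_factor => j; apply/AexS; apply: mulmx_rows0.
  by rewrite -mulmxA phi'E -psiE mulmxA (B'0 i.+1) mul0mx.
pose phi i : 'M_(s' i.+1, r i) := sval (f i).
have phi_homog i j k : phi i j k \is 1.-homog by case: (svalP (f i)).
have phi0E : phi 0%N *m a = B' 0%N *m u%:M by rewrite /phi f0.
have phiSE i : phi i.+1 *m A i = B' i.+1 *m phi i by apply: fE.
(* With this sign the lower left block of the composite of two differentials is
   [phi i.+1 *m A i - B' i.+1 *m phi i], which is zero by [phiSE]. *)
exists (fun i => (r i + s' i)%N), (fun i => block_mx (A i) 0 (phi i) (- B' i)),
  (col_mx a (u%:M : 'M_1)); split.
- by move=> j; rewrite mxE; case: split => k //; rewrite ord1 mxE mulr1n.
- move=> i j k; rewrite !mxE; case: split => j'; rewrite mxE;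
    case: split => k' //; first by rewrite mxE rpred0.
  by rewrite mxE rpredN.
split=> /=.
- move=> p; split.
    case=> q /memJ [w ->] [c ->]; exists (row_mx w (c%:M : 'M_1)).
    by rewrite mul_row_col [RHS]mxE -scalar_mxM [X in _ = _ + X]mxE mulr1n.
  case=> v ->; rewrite -[v]hsubmxK mul_row_col mxE.
  exists ((lsubmx v *m a) 0 0); first by apply/memJ; exists (lsubmx v).
  by exists (rsubmx v 0 0); rewrite mul_mx_scalar [X in _ + X]mxE mulrC.
- move=> v; split; last first.
    case=> w ->; rewrite -mulmxA mul_block_col mul0mx addr0 phi0E mulNmx subrr.
    have -> : A 0%N *m a = 0.
      apply/row_matrixP => j; rewrite row_mul row0; apply/Aex0.
      by exists (delta_mx 0 j); rewrite -rowE.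
    by rewrite col_mx0 mulmx0.
  rewrite -[v]hsubmxK; move: (lsubmx v) (rsubmx v) => v1 v2.
  rewrite mul_row_col => v0.
  have [w v2E] : exists w, v2 = w *m b.
    have /memL [w wE] : L (v2 0 0).
      apply/JL/memJ; exists (- v1); rewrite mulNmx [RHS]mxE.
      move: v0; rewrite mul_mx_scalar => /matrixP/(_ 0 0).
      rewrite mxE [X in _ + X]mxE [RHS]mxE mulrC => /eqP.
      by rewrite addrC addr_eq0 => /eqP.
    by exists w; apply/rowP => k; rewrite ord1.
  have /Aex0 [z zE] : (v1 + w *m phi 0%N) *m a = 0.
    by rewrite mulmxDl -mulmxA phi0E mulmxA -v2E.
  exists (row_mx z (- w)); rewrite mul_row_block mulmx0 add0r mulNmx mulNmx.
  by rewrite mulmxN opprK -zE addrK v2E.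
move=> i v; split; last first.
  case=> w ->; rewrite -mulmxA mulmx_block !mul0mx !mulmx0 !addr0 add0r.
  rewrite phiSE mulNmx mulmxN mulNmx opprK subrr.
  have -> : A i.+1 *m A i = 0.
    apply/row_matrixP => j; rewrite row_mul row0; apply/AexS.
    by exists (delta_mx 0 j); rewrite -rowE.
  by rewrite B'0 block_mx0 mulmx0.
rewrite -[v]hsubmxK; move: (lsubmx v) (rsubmx v) => v1 v2.
rewrite mul_row_block mulmx0 add0r -[0]hsubmxK => /eq_row_mx [].
rewrite !linear0 => v10; rewrite mulmxN => /eqP; rewrite oppr_eq0 => /eqP.
move/B'ex => [w v2E].
have /AexS [z zE] : (v1 + w *m phi i.+1) *m A i = 0.
  by rewrite mulmxDl -mulmxA phiSE mulmxA -v2E.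
exists (row_mx z (- w)); rewrite mul_row_block mulmx0 add0r mulNmx mulNmx.
by rewrite mulmxN opprK -zE addrK v2E.
Qed.

End MappingCone.

(** * Linear quotients *)

Section LinearQuotients.
Context {K : fieldType} {n : nat}.
Implicit Types (I J : {mpoly K[n]} -> Prop) (S : 'X_{1..n} -> Prop).
Implicit Types (u v m : 'X_{1..n}) (us : seq 'X_{1..n}).

Lemma eq_linres I J d : same_ideal I J -> linres I d -> linres J d.
Proof.
move=> IJ [r [A [a [ah Ah [memI ex0 exS]]]]]; exists r, A, a; split=> //.
by split=> // p; rewrite -memI; split=> /IJ.
Qed.

Lemma linres_zero d : linres (fun p : {mpoly K[n]} => p = 0) d.
Proof.
exists (fun=> 0%N), (fun i => 0), 0; split; [by case|by move=> ? []|].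
split=> [p|v|i v] /=.
- by split=> [->|[v ->]]; [exists 0|]; rewrite mulmx0 mxE.
- by split=> _; [exists 0|]; rewrite [v]thinmx0 mul0mx.
- by split=> _; [exists 0|]; rewrite [v]thinmx0 mul0mx.
Qed.

Definition variables (T : pred 'I_n) : {mpoly K[n]} -> Prop :=
  monomial_span (fun m => exists2 i, T i & m = U_(i)%MM).

Lemma variablesP T (p : {mpoly K[n]}) : variables T p <->
  {in msupp p, forall m, exists2 i, T i & (0 < m i)%N}.
Proof.
rewrite /variables monomial_spanP; split=> Tp m /Tp.
  by case=> _ [i Ti ->]; rewrite lep1mP -lt0n; exists i.
by case=> i Ti mi; exists U_(i)%MM; [exists i | rewrite lep1mP -lt0n].
Qed.

(** The two conditions on [T] say that the colon ideal of (S) by u is generated by the variables in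
    [T]: the first bounds it from above, the second from below. The mapping cone then applies. *)
Lemma linres_add_monomial S u (T : pred 'I_n) d :
    linres (monomial_span S : {mpoly K[n]} -> Prop) d -> mdeg u = d ->
    linres (variables T) 1 ->
    (forall v, S v -> exists2 i, T i & (u i < v i)%N) ->
    (forall i, T i -> exists2 v, S v & (v <= u + U_(i))%MM) ->
  linres (monomial_span (mon_union S (eq^~ u)) : {mpoly K[n]} -> Prop) d.
Proof.
move=> linS u_deg linT Tdown Tup.
have u_homog : ('X_[u] : {mpoly K[n]}) \is d.-homog by rewrite dhomogX; apply/eqP.
have colon p : monomial_span S (p * 'X_[u]) <-> variables T p.
  rewrite monomial_spanP variablesP; split=> Sp m m_in.
    have [|v Sv /mnm_lepP vm] := Sp (u + m)%MM.
      by rewrite mcoeff_msupp mcoeffMX -mcoeff_msupp.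
    have [i Ti uv] := Tdown v Sv; exists i => //.
    by have := vm i; rewrite mnmDE; lia.
  move: m_in; rewrite mulrC => /msuppXM [um /Sp [i Ti mi]].
  have [v Sv vu] := Tup i Ti; exists v => //; apply: (lepm_trans vu).
  rewrite -(submK um) addmC; apply/mnm_lepP => j; rewrite !mnmDE.
  by rewrite leq_add2r; apply/mnm_lepP; rewrite lep1mP -lt0n.
apply: eq_linres (linres_cone linS linT u_homog colon) => p; split.
  case=> q Sq [c ->]; apply: ideal_spanD.
    by apply: monomial_span_mono Sq => m; left.
  by apply: ideal_span_mul; exists u; [right|].
(* Once the multiples of u are split off, each remaining monomial must be covered by a generator in
   [S]. *)
have [c [r [pE rP]]] := mpoly_split p u => /monomial_spanP Sp.
exists r; last by exists c; rewrite pE mulrC addrC.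
apply/monomial_spanP => m /rP /andP[/Sp [v [Sv|->] vm] um]; first by exists v.
by rewrite vm in um.
Qed.

(** A variable is regular modulo the ideal of other variables, so the colon ideal is the ideal
    already reached: [lin_s] serves both as the ideal and as the colon. The iterated cone is a
    Koszul complex. *)
Lemma linres_variables (T : pred 'I_n) : linres (variables T) 1.
Proof.
suff lin_seq (s : seq 'I_n) : uniq s -> linres (variables (fun j => j \in s)) 1.
  apply: eq_linres (lin_seq (enum T) (enum_uniq _)) => p.
  by apply: eq_monomial_span => m; split=> -[i Ti ->]; exists i => //;
    move: Ti; rewrite /= mem_enum.
elim: s => [_|i s IHs /= /andP[i_notin /IHs lin_s]].
  apply: eq_linres (linres_zero 1) => p; split=> [->|]; first exact: ideal_span0.
  move/variablesP => p0; apply: msuppnil0; case: msupp p0 => // m l /(_ m).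
  by rewrite inE eqxx => -[].
apply: eq_linres (linres_add_monomial (u := U_(i)%MM) lin_s (mdeg1 i) lin_s _ _).
- move=> p; apply: eq_monomial_span => m; split.
    by case=> [[j js ->]|->];
      [exists j; rewrite //= inE js orbT|exists i; rewrite //= inE eqxx].
  by case=> j; rewrite /= inE => /orP[/eqP -> ->|js ->]; [right|left; exists j].
- move=> _ [j js ->]; exists j => //; rewrite !mnm1E eqxx.
  by case: eqP i_notin => // ->; rewrite js.
- by move=> j js; exists U_(j)%MM; [exists j|rewrite lem_addl].
Qed.

End LinearQuotients.

(** * First and second syzygies *)

Section LinearSyzygies.
Context {K : fieldType} {n : nat}.
Implicit Types (u v w m : 'X_{1..n}) (G : seq 'X_{1..n}) (p q : {mpoly K[n]}).

Lemma mcoeff_mul_part0 (P : pred 'X_{1..n}) p q w :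
    (forall l, l \in msupp q -> P l -> (l <= w)%MM -> False) ->
  (p * mpart P q)@_w = 0.
Proof.
move=> Pq; apply/eqP; rewrite mcoeff_eq0; apply/negP.
case/msuppM_le/allpairsP => -[k l] /= [_]; rewrite msupp_part => /andP[Pl l_in] wE.
by apply: (Pq l l_in Pl); rewrite wE lem_addl.
Qed.

Lemma mpart_predC (P : pred 'X_{1..n}) p : mpart P p + mpart (predC P) p = p.
Proof.
by apply/mpolyP => m; rewrite mcoeffD !mcoeff_part /=; case: ifP;
  rewrite ?addr0 ?add0r.
Qed.

Lemma mdeg_sub u v : (u <= v)%MM -> mdeg (v - u)%MM = (mdeg v - mdeg u)%N.
Proof. by move=> uv; rewrite -[in RHS](submK uv) mdegD addnK. Qed.

Lemma eq_lem_mdeg u v : (u <= v)%MM -> mdeg u = mdeg v -> u = v.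
Proof.
move=> uv uvE; have := submK uv; have : mdeg (v - u)%MM == 0%N.
  by rewrite mdeg_sub // uvE subnn.
by rewrite mdeg_eq0 => /eqP ->; rewrite add0m.
Qed.

Definition antichain G := {in G &, forall u v, (u <= v)%MM -> u = v}.

Lemma linres_mdeg G d : antichain G ->
    linres (monomial_span (fun m => m \in G) : {mpoly K[n]} -> Prop) d ->
  {in G, forall u, mdeg u = d}.
Proof.
move=> antiG [r [A [a [a_homog _ [memI _ _]]]]] u uG.
have /memI /= [v /(congr1 (fun p => u \in msupp p))] :
    monomial_span (fun m => m \in G) ('X_[u] : {mpoly K[n]}).
  by apply/monomial_spanX; exists u; rewrite ?lepm_refl.
rewrite msuppX mem_head => /esym; rewrite mxE.
case/msupp_sum_le/flatten_mapP => j _ /msuppM_le/allpairsP [[k l] /= [_ l_in uE]].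
have /monomial_spanP /(_ l l_in) [u' u'G u'l] :
    monomial_span (fun m => m \in G) (a j 0).
  by apply/memI; exists (delta_mx 0 j); rewrite -rowE mxE.
have lu : (l <= u)%MM by rewrite uE lem_addl.
have u'E : u' = u by apply: antiG => //; apply: lepm_trans u'l lu.
suff <- : l = u by apply: (dhomogP _ _ _ (a_homog j)).
by apply/mnmP => i; apply/eqP; rewrite eqn_leq (mnm_lepP lu) -u'E (mnm_lepP u'l).
Qed.

(* Truncating the augmentation to the generators in [C] gives a functional
   that kills every linear syzygy unless some generators on both sides of [C]
   divide a common multiple of degree d + 1. *)
Lemma linres_connected G d (C : pred 'X_{1..n}) w u0 v0 :
    linres (monomial_span (fun m => m \in G) : {mpoly K[n]} -> Prop) d ->
    {in G, forall u, mdeg u = d} ->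
    u0 \in G -> v0 \in G -> (u0 <= w)%MM -> (v0 <= w)%MM -> C u0 -> ~~ C v0 ->
  exists u v, [/\ u \in G, v \in G, C u & ~~ C v] /\
    [/\ (u <= w)%MM, (v <= w)%MM & exists i j, (u + U_(j) = v + U_(i))%MM].
Proof.
move=> [r [A [a [a_homog A_homog [memI ex0 _]]]]] Gd u0G v0G u0w v0w Cu0 Cv0.
rewrite /= in memI ex0.
apply: Classical_Prop.NNPP => none.
have a_supp j l : l \in msupp (a j 0) -> l \in G.
  move=> l_in; have /monomial_spanP /(_ l l_in) [u uG ul] :
      monomial_span (fun m => m \in G) (a j 0).
    by apply/memI; exists (delta_mx 0 j); rewrite -rowE mxE.
  rewrite -(eq_lem_mdeg ul) // Gd //; symmetry.
  exact: (dhomogP _ _ _ (a_homog j)).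
have aC0 : A 0%N *m a = 0.
  apply/row_matrixP => j; rewrite row_mul row0; apply/ex0.
  by exists (delta_mx 0 j); rewrite -rowE.
pose aC := map_mx (mpart C) a; pose aN := map_mx (mpart (predC C)) a.
have aCN : a = aC + aN by apply/matrixP => i j; rewrite !mxE mpart_predC.
have coefC0 s (v : 'M_(s, _)) i w' :
    {in G, forall l, C l -> (l <= w')%MM -> False} -> ((v *m aC) i 0)@_w' = 0.
  move=> noC; rewrite mxE raddf_sum big1 // => j _; rewrite mxE /=.
  by apply: mcoeff_mul_part0 => l /a_supp; apply: noC.
have coefN0 s (v : 'M_(s, _)) i w' :
    {in G, forall l, ~~ C l -> (l <= w')%MM -> False} -> ((v *m aN) i 0)@_w' = 0.
  move=> noC; rewrite mxE raddf_sum big1 // => j _; rewrite mxE /=.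
  by apply: mcoeff_mul_part0 => l /a_supp; apply: noC.
(* If no generator in [C] divides w', then [aC] contributes nothing at w'. Otherwise none outside
   [C] does, by [none], and [aC] may be replaced by [a], which the syzygy kills. *)
have linear_w' j w' : (w' <= w)%MM -> mdeg w' = d.+1 -> ((A 0%N *m aC) j 0)@_w' = 0.
  move=> w'w w'd.
  have [/hasP [u uG /andP[Cu uw']]|noC] := boolP (has (fun u => C u && (u <= w')%MM) G);
    last first.
    by apply: coefC0 => l lG Cl lw'; case/hasP: noC; exists l; rewrite ?Cl.
  have -> : aC = a - aN by rewrite aCN addrK.
  rewrite mulmxBr aC0 sub0r mxE mcoeffN coefN0 ?oppr0 // => v vG Cv vw'.
  case: none; exists u, v; split=> //; split; try exact: lepm_trans w'w.
  have cover z : z \in G -> (z <= w')%MM -> exists i, w' = (z + U_(i))%MM.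
    move=> zG zw'; have : mdeg (w' - z)%MM == 1%N.
      by rewrite mdeg_sub // (Gd z zG) w'd subSnn.
    rewrite mdeg_eq1 => /existsP [i /eqP zE]; exists i.
    by rewrite -zE addmC submK.
  have [j' w'E] := cover u uG uw'; have [i' w'E'] := cover v vG vw'.
  by exists i', j'; rewrite -w'E -w'E'.
have [c cE] : exists c : 'rV_(r 0%N), 'X_[u0] = (c *m a) 0 0.
  by apply/memI/monomial_spanX; exists u0; rewrite ?lepm_refl.
have [c' c'E] : exists c' : 'rV_(r 0%N), 'X_[v0] = (c' *m a) 0 0.
  by apply/memI/monomial_spanX; exists v0; rewrite ?lepm_refl.
have eq_deg l u : l \in G -> u \in G -> (l <= u)%MM -> l = u.
  by move=> lG uG lu; apply: eq_lem_mdeg; rewrite ?Gd.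
have cC : ((c *m aC) 0 0)@_u0 = 1.
  have -> : aC = a - aN by rewrite aCN addrK.
  rewrite mulmxBr mxE -cE [X in _ + X]mxE mcoeffB mcoeffX eqxx coefN0 ?subr0 //.
  by move=> l lG Cl /(eq_deg _ _ lG u0G) lE; rewrite lE Cu0 in Cl.
have c'C : ((c' *m aC) 0 0)@_v0 = 0.
  apply: coefC0 => l lG Cl /(eq_deg _ _ lG v0G) lE.
  by rewrite -lE Cl in Cv0.
have /ex0 [z zE] : ('X_[w - u0] *: c - 'X_[w - v0] *: c') *m a = 0.
  rewrite mulmxBl -!scalemxAl [c *m a]mx11_scalar -cE [c' *m a]mx11_scalar -c'E.
  by rewrite !scale_scalar_mx -!mpolyXD !submK // subrr.
(* On the syzygy between u0 and v0 at w, the functional sees only the u0 side and takes the value 1;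
   yet this syzygy is a combination of linear ones, on which it vanishes. *)
have : ((('X_[w - u0] *: c - 'X_[w - v0] *: c') *m aC) 0 0)@_w = 1.
  rewrite mulmxBl -!scalemxAl mxE [X in X + _]mxE [X in _ + X]mxE.
  have subw u : (u <= w)%MM -> (w - (w - u))%MM = u.
    by move=> uw; rewrite submBA // addmC addmK.
  rewrite [X in _ - X]mxE mcoeffB.
  by rewrite !mcoeffXM ?lem_subr // !subw // cC c'C subr0.
rewrite zE -mulmxA mxE raddf_sum /= big1 => [/eqP|j _].
  by rewrite eq_sym oner_eq0.
apply/eqP; rewrite mcoeff_eq0; apply/negP.
case/msuppM_le/allpairsP => -[k l] /= [_ l_in wE].
have l_deg : mdeg l = d.+1.
  apply: (dhomogP _ _ _ (_ : (A 0%N *m aC) j 0 \is (1 + d).-homog)) l_in.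
  apply: mulmx_homog (A_homog 0%N) _ j 0 => i i'; rewrite mxE ord1.
  apply/dhomogP => m; rewrite msupp_part => /andP[_].
  exact: (dhomogP _ _ _ (a_homog i)).
by move: l_in; rewrite mcoeff_msupp linear_w' ?eqxx // wE lem_addl.
Qed.

End LinearSyzygies.

(** * Second syzygies and colons by three variables *)

Section SecondSyzygies.
Context {K : fieldType} {n : nat}.
Implicit Types (m : 'X_{1..n}) (p q : {mpoly K[n]}).

Lemma mpoly_ideal2 (i j : 'I_n) p :
    {in msupp p, forall m, (0 < m i)%N || (0 < m j)%N} ->
  exists c : {mpoly K[n]} * {mpoly K[n]}, p = 'X_i * c.1 + 'X_j * c.2.
Proof.
move=> ij; have [q [r [pE rP]]] := mpoly_split p U_(i)%MM.
have /mpoly_dividesX [c rE] : {in msupp r, forall m, (U_(j) <= m)%MM}.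
  move=> m /rP /andP[m_in]; have := ij m m_in; rewrite !lep1mP !lt0n negbK.
  by case/orP => [/negbTE ->|].
by exists (q, c); rewrite pE rE.
Qed.

Lemma row_ideal2 (i j : 'I_n) r (v : 'rV[{mpoly K[n]}]_r) :
    (forall k, {in msupp (v 0 k), forall m, (0 < m i)%N || (0 < m j)%N}) ->
  exists a b, v = 'X_i *: a + 'X_j *: b.
Proof.
move=> vP; have [f fE] := fin_all_exists (fun k => mpoly_ideal2 (@vP k)).
exists (\row_k (f k).1), (\row_k (f k).2).
by apply/rowP => k; rewrite !mxE fE.
Qed.

Lemma row_ideal3 (i j l : 'I_n) r (v : 'rV[{mpoly K[n]}]_r) :
    (forall k, {in msupp (v 0 k), forall m,
      [|| (0 < m i)%N, (0 < m j)%N | (0 < m l)%N]}) ->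
  exists a b c, v = 'X_i *: a + 'X_j *: b + 'X_l *: c.
Proof.
move=> vP.
have [f fE] := fin_all_exists (fun k => mpoly_split (v 0 k) U_(i)%MM).
have [g gE] := fin_all_exists fE.
have [a [b abE]] : exists a b, \row_k g k = 'X_j *: a + 'X_l *: b.
  apply: row_ideal2 => k m; rewrite mxE; case: (gE k) => _ gP.
  move=> /gP/andP[m_in]; have := vP k m m_in; rewrite lep1mP negbK lt0n.
  by case/orP => [/negbTE ->|].
exists (\row_k f k), a, b; rewrite -addrA -abE.
by apply/rowP => k; rewrite !mxE; case: (gE k).
Qed.

Lemma row_coprimeX (i j : 'I_n) r (v w : 'rV[{mpoly K[n]}]_r) : i != j ->
  'X_i *: v = 'X_j *: w -> exists c, w = 'X_i *: c.
Proof.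
move=> ij /rowP vw.
have /fin_all_exists [c cE] : forall k, exists c, w 0 k = 'X_i * c.
  move=> k; have := vw k; rewrite !mxE.
  case/coprimeX_divides => [l|c [_ ->]]; last by exists c.
  rewrite !mnm1E; case: (eqVneq i l) ij => [->|]; last by left.
  by rewrite eq_sym => /negbTE ->; right.
by exists (\row_k c k); apply/rowP => k; rewrite !mxE cE.
Qed.

Definition in_vars (T : pred 'I_n) m := [forall i, (0 < m i)%N ==> T i].

Lemma mpart_in_varsM (T : pred 'I_n) p q :
  mpart (in_vars T) (p * q) = mpart (in_vars T) p * mpart (in_vars T) q.
Proof.
apply: mpartM => k l _ _; apply/forallP/andP => [kl|[/forallP k_in /forallP l_in] i].
  by split; apply/forallP => i; apply/implyP => ki; apply: (implyP (kl i));
    rewrite mnmDE addn_gt0 ki ?orbT.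
by rewrite mnmDE addn_gt0; apply/implyP => /orP[]; apply/implyP.
Qed.

Definition mx_part (T : pred 'I_n) s r (M : 'M[{mpoly K[n]}]_(s, r)) :=
  map_mx (mpart (in_vars T)) M.

Lemma mx_part0 (T : pred 'I_n) s r : mx_part T (0 : 'M_(s, r)) = 0.
Proof. by apply/matrixP => i j; rewrite !mxE linear0. Qed.

Lemma mx_partB (T : pred 'I_n) s r (V W : 'M_(s, r)) :
  mx_part T (V - W) = mx_part T V - mx_part T W.
Proof. by apply/matrixP => i j; rewrite !mxE linearB. Qed.

Lemma mx_partD (T : pred 'I_n) s r (V W : 'M_(s, r)) :
  mx_part T (V + W) = mx_part T V + mx_part T W.
Proof. by apply/matrixP => i j; rewrite !mxE linearD. Qed.

Lemma mx_partX (T : pred 'I_n) s r i (V : 'M_(s, r)) : T i ->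
  mx_part T ('X_i *: V) = 'X_i *: mx_part T V.
Proof.
move=> Ti; apply/matrixP => k l; rewrite !mxE mpart_in_varsM; congr (_ * _).
apply: mpart_id => m; rewrite msuppX inE => /eqP ->; apply/forallP => j.
by rewrite mnm1E lt0b; apply/implyP => /eqP <-.
Qed.

Lemma mx_partM (T : pred 'I_n) s t r (V : 'M_(s, t)) (W : 'M_(t, r)) :
  mx_part T (V *m W) = mx_part T V *m mx_part T W.
Proof.
apply/matrixP => i j; rewrite !mxE linear_sum /=; apply: eq_bigr => k _.
by rewrite mpart_in_varsM !mxE.
Qed.

(* The Koszul cycle of [f], lifted along the resolution and reduced modulo the
   variables other than [x], [y], [z], becomes a boundary because the second
   syzygies are generated in degree [d + 2]. *)
Lemma linres_colon3 (S : 'X_{1..n} -> Prop) d e (x y z : 'I_n) (f : {mpoly K[n]}) :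
    linres (monomial_span S : {mpoly K[n]} -> Prop) d ->
    x != y -> x != z -> y != z -> f \is e.-homog -> (d <= e)%N ->
    {in msupp f, forall m, in_vars (pred3 x y z) m} ->
    monomial_span S ('X_x * f) -> monomial_span S ('X_y * f) ->
    monomial_span S ('X_z * f) ->
  monomial_span S f.
Proof.
case=> r [A [a [a_homog A_homog [memI ex0 exS]]]] xy xz yz f_homog de f_vars.
(* The degree of the lifts to the free module: x f has degree e + 1 and the entries of [a] have
   degree d. *)
rewrite /= in memI ex0 exS; pose k := (e - d).+1.
have ek : (1 + e)%N = (k + d)%N by rewrite add1n /k addSn subnK.
have a_hom i (j : 'I_1) : a i j \is d.-homog by rewrite ord1.
have aug i : monomial_span S ('X_i * f) -> exists2 g : 'rV_(r 0%N),
    (forall j l, g j l \is k.-homog) & (g *m a) 0 0 = 'X_i * f.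
  move=> /memI [v vE]; have [|g g_hom gE] := @homog_lift _ _ _ _ _ v a k d a_hom.
    move=> j l; rewrite !ord1 -vE -ek; apply: dhomogM f_homog.
    by rewrite dhomogX; apply/eqP/mdeg1.
  by exists g => //; rewrite gE vE.
move=> /aug[gx gx_hom gxE] /aug[gy gy_hom gyE] /aug[gz gz_hom gzE].
have X_hom (i : 'I_n) (g : 'rV_(r 0%N)) : (forall j l, g j l \is k.-homog) ->
    forall j l, ('X_i *: g) j l \is (k + 1).-homog.
  move=> g_hom j l; rewrite mxE addnC; apply: dhomogM => //.
  by rewrite dhomogX; apply/eqP/mdeg1.
have syz1 i j (g g' : 'rV_(r 0%N)) : (forall j l, g j l \is k.-homog) ->
    (forall j l, g' j l \is k.-homog) -> (g *m a) 0 0 = 'X_i * f ->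
    (g' *m a) 0 0 = 'X_j * f -> exists2 h : 'rV_(r 1%N),
    (forall j l, h j l \is k.-homog) & h *m A 0%N = 'X_i *: g' - 'X_j *: g.
  move=> g_hom g'_hom gE g'E.
  have /ex0 [w wE] : ('X_i *: g' - 'X_j *: g) *m a = 0.
    rewrite mulmxBl -!scalemxAl [g *m a]mx11_scalar [g' *m a]mx11_scalar gE g'E.
    by rewrite !scale_scalar_mx mulrCA subrr.
  have [|h h_hom hE] := homog_lift (V := w) (k := k) (A_homog 0%N).
    move=> s t; rewrite -wE mxE [X in _ + X]mxE.
    by apply: rpredB; apply: X_hom.
  by exists h => //; rewrite hE.
have [hyz hyz_hom hyzE] := syz1 y z gy gz gy_hom gz_hom gyE gzE.
have [hxz hxz_hom hxzE] := syz1 x z gx gz gx_hom gz_hom gxE gzE.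
have [hxy hxy_hom hxyE] := syz1 x y gx gy gx_hom gy_hom gxE gyE.
have [t t_hom tE] : exists2 t : 'rV_(r 2%N), (forall j l, t j l \is k.-homog) &
    t *m A 1%N = 'X_x *: hyz - 'X_y *: hxz + 'X_z *: hxy.
  have /exS [w wE] : ('X_x *: hyz - 'X_y *: hxz + 'X_z *: hxy) *m A 0%N = 0.
    rewrite mulmxDl mulmxBl -!scalemxAl hyzE hxzE hxyE.
    by apply/rowP => l; rewrite !mxE; ring.
  have [|t t_hom tE] := homog_lift (V := w) (k := k) (A_homog 1%N).
    have X_hom' (i : 'I_n) (g : 'rV_(r 1%N)) : (forall j l, g j l \is k.-homog) ->
        forall j l, ('X_i *: g) j l \is (k + 1).-homog.
      move=> g_hom j l; rewrite mxE addnC; apply: dhomogM => //.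
      by rewrite dhomogX; apply/eqP/mdeg1.
    move=> i j; rewrite -wE mxE [X in X + _]mxE [X in _ + X + _]mxE.
    by apply: rpredD; [apply: rpredB|]; apply: X_hom'.
  by exists t => //; rewrite tE.
set T := pred3 x y z in f_vars.
have Tx : T x by rewrite /= eqxx.
have Ty : T y by rewrite /= eqxx orbT.
have Tz : T z by rewrite /= eqxx !orbT.
(* The entries of [t] have positive degree [k], and only x, y and z survive the truncation, so the
   truncated entries lie in (x, y, z). *)
have [t1 [t2 [t3 ptE]]] : exists a b c, mx_part T t = 'X_x *: a + 'X_y *: b + 'X_z *: c.
  apply: row_ideal3 => l m; rewrite mxE msupp_part => /andP[/forallP m_vars].
  move/(dhomogP _ _ _ (t_hom 0 l)) => m_deg.
  have [i mi] : exists i, (0 < m i)%N.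
    apply/existsP; apply: contraPT m_deg; rewrite negb_exists => /forallP m0.
    suff -> : m = 0%MM by rewrite mf0.
    by apply/mnmP => i; rewrite mnm0E; apply/eqP; rewrite -leqn0 leqNgt m0.
  by have := implyP (m_vars i) mi; rewrite /= => /or3P[] /eqP iE; rewrite -iE mi ?orbT.
have AA0 : mx_part T (A 1%N) *m mx_part T (A 0%N) = 0.
  rewrite -mx_partM (_ : _ *m _ = 0) ?mx_part0 //.
  apply/row_matrixP => j; rewrite row_mul row0; apply/exS.
  by exists (delta_mx 0 j); rewrite -rowE.
have Aa0 : mx_part T (A 0%N) *m mx_part T a = 0.
  rewrite -mx_partM (_ : _ *m _ = 0) ?mx_part0 //.
  apply/row_matrixP => j; rewrite row_mul row0; apply/ex0.
  by exists (delta_mx 0 j); rewrite -rowE.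
(* Changing the three syzygies by these boundaries makes the Koszul cycle vanish exactly: x q1 - y
   q2 + z q3 = 0. Hence q3 has entries in (x, y). *)
pose q1 := mx_part T hyz - t1 *m mx_part T (A 1%N).
pose q2 := mx_part T hxz + t2 *m mx_part T (A 1%N).
pose q3 := mx_part T hxy - t3 *m mx_part T (A 1%N).
have qE : 'X_z *: q3 = 'X_y *: q2 - 'X_x *: q1.
  have /eqP : 'X_x *: q1 - 'X_y *: q2 + 'X_z *: q3 = 0.
    transitivity (mx_part T (t *m A 1%N) - mx_part T t *m mx_part T (A 1%N));
      last by rewrite mx_partM subrr.
    rewrite tE mx_partD mx_partB !mx_partX // ptE !mulmxDl -!scalemxAl /q1 /q2 /q3.
    by apply/rowP => l; rewrite !mxE; ring.
  by rewrite addrC addr_eq0 => /eqP ->; rewrite opprB.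
have [b1 [b2 q3E]] : exists a b, q3 = 'X_x *: a + 'X_y *: b.
  apply: row_ideal2 => l m m_in.
  have : (m + U_(z))%MM \in msupp (('X_z *: q3) 0 l).
    by rewrite mxE mcoeff_msupp mcoeffXM ?lem_addl // addmK -mcoeff_msupp.
  rewrite qE !mxE => /msuppB_le; rewrite mem_cat => /orP[] /msuppXM [];
    rewrite lep1mP mnmDE mnm1E [z == _]eq_sym.
    by rewrite (negbTE yz) addn0 -lt0n => ->; rewrite orbT.
  by rewrite (negbTE xz) addn0 -lt0n => ->.
(* Inserting q3 = x b1 + y b2 into the syzygy between [gx] and [gy] gives, after truncation, x (gy -
   b1 A) = y (gx + b2 A), so x divides the second bracket. Applying [a] and cancelling x writes f as
   a value of the truncated augmentation. *)
have [b bE] : exists b, mx_part T gx + b2 *m mx_part T (A 0%N) = 'X_x *: b.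
  apply: (@row_coprimeX x y _ (mx_part T gy - b1 *m mx_part T (A 0%N))) => //.
  have : mx_part T hxy *m mx_part T (A 0%N) =
      ('X_x *: b1 + 'X_y *: b2) *m mx_part T (A 0%N).
    by rewrite -q3E mulmxBl -mulmxA AA0 mulmx0 subr0.
  rewrite -mx_partM hxyE mx_partB !mx_partX // mulmxDl -!scalemxAl => /eqP.
  rewrite scalerBr scalerDr subr_eq => /eqP ->.
  by rewrite -[X in X - _]addrA [X in X - _]addrC addrK addrC.
have fE : f = (b *m mx_part T a) 0 0.
  have X0 : 'X_x != 0 :> {mpoly K[n]} by rewrite -msize_poly_eq0 msizeX.
  apply: (mulfI X0); have := congr1 (fun v => (v *m mx_part T a) 0 0) bE.
  rewrite mulmxDl -mulmxA Aa0 mulmx0 addr0 -mx_partM mxE gxE mpart_id.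
    by rewrite -scalemxAl [RHS]mxE.
  move=> m /msuppXM [xm m_in]; apply/forallP => i; apply/implyP => mi.
  have [->|xi] := eqVneq i x; first exact: Tx.
  apply: (implyP (forallP (f_vars _ m_in) i)).
  by rewrite mnmBE mnm1E eq_sym (negbTE xi) subn0.
(* Truncation only discards monomials, so the truncated entries of [a] stay in the monomial
   ideal. *)
apply/monomial_spanP => m; rewrite fE mxE.
case/msupp_sum_le/flatten_mapP => j _ /msuppM_le/allpairsP [[u l] /= [_ l_in ->]].
have /monomial_spanP Sa : monomial_span S (a j 0).
  by apply/memI; exists (delta_mx 0 j); rewrite -rowE mxE.
move: l_in; rewrite mxE msupp_part => /andP[_ /Sa [s Ss sl]].
by exists s => //; apply: lepm_trans sl (lem_addl _ _).
Qed.

End SecondSyzygies.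

(** * Generators of ideals with a linear resolution *)

Section MinimalGenerators.
Context {K : fieldType} {n : nat}.
Implicit Types (I : {mpoly K[n]} -> Prop) (u v m : 'X_{1..n}) (G : seq 'X_{1..n}).

Lemma mingens_antichain I G : is_mingens I G -> antichain G.
Proof.
case=> _ IG minG u v uG vG uv; apply/eqP; apply: contraT => u_v.
have : {subset G <= [seq m <- G | m != v]}.
  apply: minG => [m|p]; first by rewrite mem_filter => /andP[].
  rewrite IG; split; last first.
    by apply: monomial_span_mono => m; rewrite mem_filter => /andP[].
  move/monomial_spanP => Gp; apply/monomial_spanP => m /Gp [x xG xm].
  have [xv|x_v] := eqVneq x v; last by exists x; rewrite ?mem_filter ?x_v.
  by exists u; rewrite ?mem_filter ?u_v // (lepm_trans uv) -?xv.
by move/(_ v vG); rewrite mem_filter eqxx.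
Qed.

Lemma mingens_mem I G u : is_mingens I G -> u \in G -> I 'X_[u].
Proof.
by case=> _ IG _ uG; apply/IG/monomial_spanX; exists u; rewrite ?lepm_refl.
Qed.

Lemma mingens_dvd I G m : is_mingens I G -> I 'X_[m] -> exists2 u, u \in G & (u <= m)%MM.
Proof. by case=> _ IG _ /IG/monomial_spanX. Qed.

Lemma lepm_anti u v : (u <= v)%MM -> (v <= u)%MM -> u = v.
Proof.
move=> /mnm_lepP uv /mnm_lepP vu; apply/mnmP => i.
by apply/eqP; rewrite eqn_leq uv vu.
Qed.

Lemma mingens_subset I G G' : is_mingens I G -> is_mingens I G' -> {subset G <= G'}.
Proof.
move=> hG hG' u uG; have [v vG' vu] := mingens_dvd hG' (mingens_mem hG uG).
have [u' u'G u'v] := mingens_dvd hG (mingens_mem hG' vG').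
have u'u : u' = u by apply: (mingens_antichain hG) => //; apply: lepm_trans vu.
by rewrite (_ : u = v) //; apply: lepm_anti => //; rewrite -u'u.
Qed.

Lemma mingens_eqi I G G' : is_mingens I G -> is_mingens I G' -> G =i G'.
Proof.
move=> hG hG' u; apply/idP/idP.
  exact: mingens_subset hG hG' u.
exact: mingens_subset hG' hG u.
Qed.

Lemma mingens_size I G G' : is_mingens I G -> is_mingens I G' -> size G = size G'.
Proof.
move=> hG hG'; case: (hG) (hG') => uG _ _ [uG' _ _].
by apply/perm_size/uniq_perm => //; apply: mingens_eqi hG hG'.
Qed.

Definition supp m : {set 'I_n} := [set i | (0 < m i)%N].

(** If the supports were distinct, they would inject into those of the generators of the radical: a
    generator g of the radical dividing the squarefree part of u has a power divisible by some u' in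
    G, and supp u' <= supp g <= supp u are equalities because supports have size 2. *)
Lemma non_minimal_same_supp I G : non_minimal I -> is_mingens I G ->
    {in G, forall u, #|supp u| = 2%N} ->
  exists u v, [/\ u \in G, v \in G, u != v & supp u = supp v].
Proof.
move=> [k [l [[G0 hG0 <-] [G' hG' <-] lt_l_k]]] hG G2; move: lt_l_k.
rewrite (mingens_size hG0 hG) => lt_size; apply: Classical_Prop.NNPP => none.
have inj : {in G &, injective supp}.
  move=> u v uG vG uv; apply: Classical_Prop.NNPP => /eqP u_v.
  by case: none; exists u, v.
move: lt_size; rewrite ltnNge => /negP; apply.
rewrite -(size_map supp G) -(size_map supp G'); apply: uniq_leq_size.
  by rewrite map_inj_in_uniq //; case: hG.
move=> _ /mapP [u uG ->].
have /(mingens_dvd hG') [g gG' /mnm_lepP gu] :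
    radical I ('X_[[multinom (0 < u i)%N : nat | i < n]] : {mpoly K[n]}).
  (* No exponent of u exceeds its degree, so u divides this power of its squarefree part. *)
  exists (mdeg u); case: (hG) => _ IG _; apply/IG; rewrite mpolyXn.
  apply/monomial_spanX; exists u => //; apply/mnm_lepP => i.
  rewrite mulmnE mnmE; case: posnP => [->//|_]; rewrite mul1n.
  by rewrite mdegE (bigD1 i) //= leq_addr.
have [e] : radical I ('X_[g] : {mpoly K[n]}) by apply: mingens_mem gG'.
rewrite mpolyXn => /(mingens_dvd hG) [u' u'G /mnm_lepP u'g].
have su'g : supp u' \subset supp g.
  apply/subsetP => i; rewrite !inE => u'i; have := u'g i; rewrite mulmnE.
  by case: (posnP (g i)) => // ->; rewrite mul0n leqNgt u'i.
have sgu : supp g \subset supp u.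
  apply/subsetP => i; rewrite !inE => gi; have := gu i; rewrite mnmE.
  by case: posnP => // _; rewrite leqNgt gi.
have gu_card : (#|supp u| <= #|supp g|)%N by rewrite G2 // -(G2 u') // subset_leq_card.
apply/mapP; exists g => //; apply/eqP.
by rewrite eq_sym eqEcard sgu.
Qed.

End MinimalGenerators.

(* The generators of the six families: an edge x_a^(d-q) x_b^q, together with
   stars x_j x_a^(d-1) and x_j x_b^(d-1) attached at its two ends. *)
Definition double_star {n} (a b : 'I_n) (d lo hi : nat) (A B : pred 'I_n)
    (m : 'X_{1..n}) : Prop :=
  [\/ exists2 q, (lo <= q <= hi)%N & m = (U_(a) *+ (d - q) + U_(b) *+ q)%MM,
      exists2 j, A j & m = (U_(j) + U_(a) *+ d.-1)%MM |
      exists2 j, B j & m = (U_(j) + U_(b) *+ d.-1)%MM].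

(** [ds_lohi] encodes non-minimality: the edge carries at least two generators. The last two fields
    say that a star occurs only next to its attaching generator, x_a^(d-1) x_b for A and x_a
    x_b^(d-1) for B. *)
Record double_star_wf {n} (a b : 'I_n) (d lo hi : nat) (A B : pred 'I_n) : Prop :=
  DoubleStarWf {
    ds_neq : a != b;
    ds_lo : (0 < lo)%N;
    ds_lohi : (lo < hi)%N;
    ds_hi : (hi < d)%N;
    ds_A : forall j, A j -> (j != a) && (j != b);
    ds_B : forall j, B j -> (j != a) && (j != b);
    ds_A_lo : forall j, A j -> lo = 1%N;
    ds_B_hi : forall j, B j -> hi = d.-1
  }.

(** * Combinatorics of the generators around an edge *)

Section Combinatorics.
Local Open Scope nat_scope.
Context {n : nat} (G : seq 'X_{1..n}) (d : nat).
Implicit Types (u v w m : 'X_{1..n}) (a b c : 'I_n).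

(** The resolution enters this section only through [Gdeg], [exchange] and [no_hexagon], supplied by
    [linres_mdeg], by [linres_connected] and by [linres_colon3] with f = x_a x_b x_c. *)
Context (Gdeg : {in G, forall u, mdeg u = d}).
Context (Gsupp : {in G, forall u, #|supp u| = 2%N}).
Context (exchange : forall (C : pred 'X_{1..n}) w u0 v0,
  u0 \in G -> v0 \in G -> (u0 <= w)%MM -> (v0 <= w)%MM -> C u0 -> ~~ C v0 ->
  exists u v, [/\ u \in G, v \in G, C u & ~~ C v] /\
    [/\ (u <= w)%MM, (v <= w)%MM & exists i j, (u + U_(j) = v + U_(i))%MM]).
Context (no_hexagon : forall a b c, a != b -> a != c -> b != c -> d = 3%N ->
  (exists2 g, g \in G & (g <= U_(a) + (U_(a) + U_(b) + U_(c)))%MM) ->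
  (exists2 g, g \in G & (g <= U_(b) + (U_(a) + U_(b) + U_(c)))%MM) ->
  (exists2 g, g \in G & (g <= U_(c) + (U_(a) + U_(b) + U_(c)))%MM) -> False).

Definition on a b : pred 'X_{1..n} :=
  fun u => [forall k, (k != a) ==> (k != b) ==> (u k == 0%N)].

Lemma onP a b u : reflect (forall k, k != a -> k != b -> u k = 0%N) (on a b u).
Proof.
apply: (iffP forallP) => uab k; last first.
  by apply/implyP => ka; apply/implyP => kb; apply/eqP/uab.
by move=> ka kb; apply/eqP; have := uab k; rewrite ka kb.
Qed.

Lemma on_sym a b u : on a b u = on b a u.
Proof. by apply/onP/onP => uab k ka kb; apply: uab. Qed.

Lemma on_mdeg a b u : a != b -> on a b u -> mdeg u = (u a + u b)%N.
Proof.
move=> ab /onP uab; rewrite mdegE (bigD1 a) //= (bigD1 b) 1?eq_sym //=.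
rewrite big1 ?addn0 // => k /andP[ka kb]; exact: uab.
Qed.

Lemma on_eq a b u v : on a b u -> on a b v -> u a = v a -> u b = v b -> u = v.
Proof.
move=> /onP ua /onP va eq_a eq_b; apply/mnmP => k.
have [->//|ka] := eqVneq k a; have [->//|kb] := eqVneq k b.
by rewrite ua ?va.
Qed.

Lemma on_le a b u v : (u <= v)%MM -> on a b v -> on a b u.
Proof.
move=> /mnm_lepP uv /onP va; apply/onP => k ka kb; apply/eqP.
by rewrite -leqn0 -(va k ka kb).
Qed.

Lemma mem_on a b u : u \in G -> 0 < u a -> 0 < u b -> a != b -> on a b u.
Proof.
move=> uG ua ub ab.
have /eqP suppE : [set a; b] == supp u.
  by rewrite eqEcard Gsupp // cards2 ab andbT subUset !sub1set !inE ua ub.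
apply/onP => k ka kb; apply/eqP; rewrite -leqn0 leqNgt.
have : k \notin supp u by rewrite -suppE !inE negb_or ka kb.
by rewrite inE.
Qed.

Lemma on_pos a b u : u \in G -> a != b -> on a b u ->
  [/\ 0 < u a, 0 < u b & u a + u b = d]%N.
Proof.
move=> uG ab uab; have uE := on_mdeg ab uab; rewrite Gdeg // in uE.
have sub : supp u \subset [set a; b].
  apply/subsetP => k; rewrite !inE; apply: contraTT; rewrite negb_or.
  by case/andP=> ka kb; rewrite (onP _ _ _ uab).
have /eqP suppE : supp u == [set a; b] by rewrite eqEcard sub Gsupp // cards2 ab.
by move: (set21 a b) (set22 a b); rewrite -suppE !inE.
Qed.

Lemma ex_on a u : u \in G -> 0 < u a -> exists2 c, c != a & on a c u.
Proof.
move=> uG ua; have : 0 < #|supp u :\ a|.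
  by have := cardsD1 a (supp u); rewrite Gsupp // inE ua add1n => -[<-].
case/card_gt0P => c; rewrite !inE => /andP[ca uc].
by exists c => //; apply: mem_on => //; rewrite eq_sym.
Qed.

Lemma mlcmE u v k : (mlcm u v) k = maxn (u k) (v k).
Proof. by rewrite mnmE. Qed.

Lemma exchangeE u v i j k :
  (u + U_(j) = v + U_(i))%MM -> (u k + (j == k) = v k + (i == k))%N.
Proof. by move/mnmP/(_ k); rewrite !mnmDE !mnm1E. Qed.

(** A discrete intermediate value argument: one exchange changes the exponent of x_a by at most 1,
    and a divisor of the lcm stays on the edge. Cutting at the exponent e catches a generator just
    before the crossing. *)
Lemma on_interval a b u1 u2 e : a != b -> u1 \in G -> u2 \in G ->
    on a b u1 -> on a b u2 -> u1 a <= e <= u2 a ->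
  exists2 u, u \in G & on a b u /\ u a = e.
Proof.
move=> ab u1G u2G on1 on2 /andP[]; rewrite leq_eqVlt => /orP[/eqP <- _|u1e].
  by exists u1.
rewrite leq_eqVlt => /orP[/eqP ->|eu2]; first by exists u2.
have [||u [v [[uG vG ue ve] [uw vw [i [j uv]]]]]] :=
  @exchange (fun m => m a <= e) (mlcm u1 u2) _ _ u1G u2G
    (lem_mlcml _ _) (lem_mlcmr _ _).
- exact: ltnW.
- by rewrite -ltnNge.
exists u => //; split; last by have := exchangeE a uv; move: ue ve; clear; lia.
apply: on_le uw _; apply/onP => k ka kb.
by rewrite mlcmE (onP _ _ _ on1) // (onP _ _ _ on2).
Qed.

(* The path of generators from [u] to [v] leaves the edge {a, b} at one of the
   two generators divisible by [x_a^(d-1)] or [x_b^(d-1)]. *)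
Lemma exit_edge a b c u v : a != b -> c != a -> c != b ->
    u \in G -> v \in G -> on a b u -> on a c v ->
  exists u', [/\ u' \in G, on a b u', (u' <= mlcm u v)%MM & u' a = 1%N \/ u' b = 1%N].
Proof.
move=> ab ca cb uG vG uab vac.
have uc : u c = 0%N by apply: (onP _ _ _ uab).
have ac : a != c by rewrite eq_sym.
have [_ vc _] := on_pos vG ac vac.
have [||u' [v' [[u'G v'G u'c v'c] [u'w v'w [i [j u'v']]]]]] :=
  @exchange (fun m => m c == 0%N) (mlcm u v) _ _ uG vG (lem_mlcml _ _) (lem_mlcmr _ _).
- by rewrite uc.
- by rewrite -lt0n.
have u'ab : on a b u'.
  apply/onP => k ka kb; have [->|kc] := eqVneq k c; first exact/eqP.
  apply/eqP; rewrite -leqn0 (leq_trans (mnm_lepP u'w k)) // mlcmE.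
  by rewrite (onP _ _ _ uab) // (onP _ _ _ vac).
exists u'; split=> //.
have [u'a u'b _] := on_pos u'G ab u'ab.
have ec := exchangeE c u'v'; have ea := exchangeE a u'v'; have eb := exchangeE b u'v'.
have jc : j = c.
  apply/eqP; apply: contraR v'c => jc.
  by move: ec; rewrite (negbTE jc) (eqP u'c); case: (v' c).
rewrite jc (negbTE ca) in ea; rewrite jc (negbTE cb) in eb; rewrite -lt0n in v'c.
have [v'a|v'a] := posnP (v' a).
  by left; move: ea u'a; rewrite v'a; clear; case: (i == a); lia.
have [v'b|v'b] := posnP (v' b).
  by right; move: eb u'b; rewrite v'b; clear; case: (i == b); lia.
by have /onP/(_ c ca cb) := mem_on v'G v'a v'b ab; move: v'c => /[swap] ->.
Qed.

Section Edge.
Context (a b : 'I_n) (u1 u2 : 'X_{1..n}).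
Context (ab : a != b) (u1G : u1 \in G) (u2G : u2 \in G).
Context (on1 : on a b u1) (on2 : on a b u2) (lt12 : u1 a < u2 a).

Lemma edge_degree_ge3 : 3 <= d.
Proof.
have [p1 _ _] := on_pos u1G ab on1; have [_ p2 <-] := on_pos u2G ab on2.
by move: lt12 p1 p2; clear; lia.
Qed.

(** Suppose v is divisible by x_c^2, so that x_a has exponent at most d - 2 in v. From an edge
    generator u with u a <= d - 2, the exit x_a^(d-1) x_b does not divide the lcm, and the exit x_a
    x_b^(d-1) does so only if u a = 1. So the exponents of x_a on the edge are 1 or d - 1; as they
    form an interval with at least two elements, d = 3, and the hexagon argument concludes. *)
Lemma star_generator c v : c != a -> c != b -> v \in G -> on a c v -> v c = 1%N.
Proof.
move=> ca cb vG vac; have ac : a != c by rewrite eq_sym.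
have [va vc vE] := on_pos vG ac vac.
apply: Classical_Prop.NNPP => vc1.
have edge u : u \in G -> on a b u -> u a <= d - 2 -> u a = 1%N.
  move=> uG uab ua.
  have [u' [u'G u'ab /mnm_lepP u'w u'1]] := exit_edge ab ca cb uG vG uab vac.
  have [p1 p2 uE] := on_pos uG ab uab; have [q1 q2 u'E] := on_pos u'G ab u'ab.
  have := u'w a; have := u'w b; rewrite !mlcmE (onP _ _ _ vac b) 1?eq_sym //.
  by move: u'1 ua p1 p2 uE q1 q2 u'E va vc vE vc1; clear; lia.
have [p1 p2 E1] := on_pos u1G ab on1; have [q1 q2 E2] := on_pos u2G ab on2.
have u1a : u1 a = 1%N by apply: edge => //; move: lt12 p1 p2 E1 q1 q2 E2; clear; lia.
have [|u uG [uab ua]] := @on_interval a b u1 u2 2 ab u1G u2G on1 on2.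
  by move: lt12; rewrite u1a.
have d3 : d = 3%N.
  have : ~ u a <= d - 2 by move/(edge _ uG uab); rewrite ua.
  by move: ua lt12 E2 q2 u1a; clear; lia.
have [_ _ uE] := on_pos uG ab uab.
have coord x y z k : (U_(x) + (U_(a) + U_(y) + U_(z)))%MM k =
    ((x == k) + ((a == k) + (y == k) + (z == k)))%N by rewrite !mnmDE !mnm1E.
have bc : b != c by rewrite eq_sym.
have [_ _ E3] := on_pos u1G ab on1.
have u1b : u1 b = 2 by move: E3; rewrite u1a d3; clear; lia.
have ub : u b = 1 by move: uE; rewrite ua d3; clear; lia.
have vaE : v a = 1 by move: va vc vc1 vE; rewrite d3; clear; lia.
have vcE : v c = 2 by move: vE; rewrite vaE d3; clear; lia.
(* The generators are now x_a^2 x_b, x_a x_b^2 and x_a x_c^2, which divide the products of x_a x_b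
   x_c with x_a, x_b and x_c respectively. *)
apply: (no_hexagon ab ac bc d3).
- exists u => //; apply/mnm_lepP => k; rewrite coord.
  have [->|ka] := eqVneq k a; first by rewrite ua ?eqxx.
  have [->|kb] := eqVneq k b; last by rewrite (onP _ _ _ uab).
  by rewrite ub ?eqxx; case: (a == b).
- exists u1 => //; apply/mnm_lepP => k; rewrite coord.
  have [->|ka] := eqVneq k a; first by rewrite u1a ?eqxx; case: (b == a).
  have [->|kb] := eqVneq k b; last by rewrite (onP _ _ _ on1).
  by rewrite u1b ?eqxx; case: (a == b).
- exists v => //; apply/mnm_lepP => k; rewrite coord.
  have [->|ka] := eqVneq k a; first by rewrite vaE ?eqxx; case: (c == a).
  have [->|kc] := eqVneq k c; last by rewrite (onP _ _ _ vac).
  by rewrite vcE ?eqxx; case: (a == c); case: (b == c).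
Qed.

(** The path starts at [u2], whose exponent of x_a exceeds 1; hence x_a x_b^(d-1) does not divide
    the lcm, and the exit is x_a^(d-1) x_b. *)
Lemma star_edge c v : c != a -> c != b -> v \in G -> on a c v ->
  exists2 u, u \in G & on a b u /\ u b = 1%N.
Proof.
move=> ca cb vG vac.
have [u' [u'G u'ab /mnm_lepP u'w [u'a|u'b]]] := exit_edge ab ca cb u2G vG on2 vac;
  last by exists u'.
have [p1 p2 E1] := on_pos u1G ab on1; have [q1 q2 E2] := on_pos u2G ab on2.
have [r1 r2 E'] := on_pos u'G ab u'ab.
have := u'w b; rewrite mlcmE (onP _ _ _ vac b) 1?eq_sym //.
by move: lt12 p1 p2 E1 q1 q2 E2 r1 r2 E' u'a; clear; lia.
Qed.

End Edge.

Section NormalForm.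
Context (a b : 'I_n) (u1 u2 : 'X_{1..n}).
Context (ab : a != b) (u1G : u1 \in G) (u2G : u2 \in G).
Context (on1 : on a b u1) (on2 : on a b u2) (lt12 : u1 a < u2 a).

Lemma edge_swap : [/\ b != a, on b a u1, on b a u2 & u2 b < u1 b].
Proof.
rewrite eq_sym ab !(on_sym b a) on1 on2; split=> //.
have [_ _ E1] := on_pos u1G ab on1; have [_ _ E2] := on_pos u2G ab on2.
by move: lt12 E1 E2; clear; lia.
Qed.

Lemma star_generatorE c v : c != a -> c != b -> v \in G -> on a c v ->
  v = (U_(c) + U_(a) *+ d.-1)%MM.
Proof.
move=> ca cb vG vac; have ac : a != c by rewrite eq_sym.
have vc := star_generator ab u1G u2G on1 on2 lt12 ca cb vG vac.
have [_ _ vE] := on_pos vG ac vac.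
apply/mnmP => k; rewrite mnmDE mulmnE !mnm1E.
have [->|ka] := eqVneq k a.
  by rewrite (negbTE ca) mul1n -vE vc addn1.
have [->|kc] := eqVneq k c; first by rewrite mul0n addn0.
by rewrite (onP _ _ _ vac).
Qed.

(** Such a generator would be x_a x_c by [star_generator], of degree 2, while an edge with two
    generators needs degree at least 3. *)
Lemma no_pendant u : u \in G -> u a = 1%N -> u b = 0%N -> False.
Proof.
move=> uG ua ub; have [|c ca uac] := @ex_on a u uG; first by rewrite ua.
have ac : a != c by rewrite eq_sym.
have [_ uc uE] := on_pos uG ac uac.
have cb : c != b by apply: contraTneq uc => ->; rewrite ub.
have uc1 := star_generator ab u1G u2G on1 on2 lt12 ca cb uG uac.
by have := edge_degree_ge3 ab u1G u2G on1 on2 lt12; rewrite -uE ua uc1.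
Qed.

End NormalForm.

Lemma double_star_generators a b u1 u2 : a != b -> u1 \in G -> u2 \in G ->
    on a b u1 -> on a b u2 -> u1 a < u2 a ->
    (forall i, exists2 u, u \in G & 0 < u i) ->
  exists lo hi (A B : pred 'I_n), [/\ double_star_wf a b d lo hi A B,
    forall j, [|| j == a, j == b, A j | B j] &
    forall m, m \in G <-> double_star a b d lo hi A B m].
Proof.
move=> ab u1G u2G on1 on2 lt12 occ.
have [ba on1' on2' lt21] := edge_swap ab u1G u2G on1 on2 lt12.
(* A path towards a generator prime to x_a x_b would cross at a generator containing exactly one of
   the two variables, with exponent 1, which [no_pendant] excludes. *)
have meets v : v \in G -> 0 < v a + v b.
  move=> vG; rewrite lt0n; apply/negP => /eqP v0.
  have [||u [v' [[uG v'G u0 v'0] [_ _ [i [j uv]]]]]] :=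
    @exchange (fun m => 0 < m a + m b) (mlcm u1 v) _ _ u1G vG
      (lem_mlcml _ _) (lem_mlcmr _ _).
  - by rewrite (leq_trans _ (leq_addl _ _)) // (leq_ltn_trans _ lt21).
  - by rewrite v0.
  have ea := exchangeE a uv; have eb := exchangeE b uv.
  have iab : (i == a) + (i == b) <= 1.
    by case: (eqVneq i a) => [->|_]; rewrite ?(negbTE ab) //; case: (i == b).
  have [[ua ub]|[ub ua]] : (u a = 1 /\ u b = 0) \/ (u b = 1 /\ u a = 0).
  - by move: u0 v'0 ea eb iab; clear; lia.
  - exact: (no_pendant ab u1G u2G on1 on2 lt12 uG).
  - exact: (no_pendant ba u2G u1G on2' on1' lt21 uG).
have edge_min : exists2 u, u \in G & on a b u /\ {in G, forall v, on a b v -> u b <= v b}.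
  pose P k := has (fun u => on a b u && (u b == k)) G.
  have exP : exists k, P k by exists (u1 b); apply/hasP; exists u1; rewrite ?on1 /=.
  case: (ex_minnP exP) => k /hasP [u uG /andP[uab /eqP <-]] min_u.
  exists u => //; split=> // v vG vab; apply: min_u.
  by apply/hasP; exists v; rewrite ?vab /=.
have edge_max : exists2 u, u \in G & on a b u /\ {in G, forall v, on a b v -> v b <= u b}.
  pose P k := has (fun u => on a b u && (u a == k)) G.
  have exP : exists k, P k by exists (u1 a); apply/hasP; exists u1; rewrite ?on1 /=.
  case: (ex_minnP exP) => k /hasP [u uG /andP[uab /eqP <-]] min_u.
  exists u => //; split=> // v vG vab.
  have : u a <= v a by apply: min_u; apply/hasP; exists v; rewrite ?vab /=.
  have [_ _ uE] := on_pos uG ab uab; have [_ _ vE] := on_pos vG ab vab.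
  by move: uE vE; clear; lia.
have [umin minG [on_min min_le]] := edge_min.
have [umax maxG [on_max max_ge]] := edge_max.
have [pmin_a pmin_b minE] := on_pos minG ab on_min.
have [pmax_a pmax_b maxE] := on_pos maxG ab on_max.
pose A j := [&& j != a, j != b & (U_(j) + U_(a) *+ d.-1)%MM \in G].
pose B j := [&& j != a, j != b & (U_(j) + U_(b) *+ d.-1)%MM \in G].
have on_star j x : on x j (U_(j) + U_(x) *+ d.-1)%MM.
  apply/onP => k kx kj; rewrite mnmDE mulmnE !mnm1E.
  by rewrite !(eq_sym _ k) (negbTE kx) (negbTE kj).
have classify v : v \in G -> double_star a b d (umin b) (umax b) A B v.
  move=> vG; have [va|va] := posnP (v a); last have [vb|vb] := posnP (v b).
  - have vb : 0 < v b by have := meets v vG; rewrite va.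
    have [c cb vbc] := ex_on vG vb.
    have bc : b != c by rewrite eq_sym.
    have [_ vc _] := on_pos vG bc vbc.
    have ca : c != a by apply: contraTneq vc => ->; rewrite va.
    have vE := star_generatorE ba u2G u1G on2' on1' lt21 cb ca vG vbc.
    by apply: Or33; exists c; rewrite // /B ca cb -vE.
  - have [c ca vac] := ex_on vG va.
    have ac : a != c by rewrite eq_sym.
    have [_ vc _] := on_pos vG ac vac.
    have cb : c != b by apply: contraTneq vc => ->; rewrite vb.
    have vE := star_generatorE ab u1G u2G on1 on2 lt12 ca cb vG vac.
    by apply: Or32; exists c; rewrite // /A ca cb -vE.
  - have vab := mem_on vG va vb ab; have [_ _ vE] := on_pos vG ab vab.
    apply: Or31; exists (v b); first by rewrite min_le // max_ge.
    apply/mnmP => k; rewrite mnmDE !mulmnE !mnm1E -vE addnK.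
    have [->|ka] := eqVneq k a; first by rewrite (negbTE ba) mul1n addn0.
    have [->|kb] := eqVneq k b; first by rewrite mul1n.
    by rewrite (onP _ _ _ vab).
exists (umin b), (umax b), A, B; split.
- split=> //.
  + have := min_le u2 u2G on2; have := max_ge u1 u1G on1.
    by move: lt21; clear; lia.
  + by move: pmax_a maxE; clear; lia.
  + by move=> j /andP[-> /andP[-> _]].
  + by move=> j /andP[-> /andP[-> _]].
  + move=> j /and3P[ja jb jG].
    have [u uG [uab ub]] := star_edge ab u1G u2G on1 on2 lt12 ja jb jG (on_star j a).
    by have := min_le u uG uab; rewrite ub; move: pmin_b; clear; lia.
  + move=> j /and3P[ja jb jG].
    have [u uG []] := star_edge ba u2G u1G on2' on1' lt21 jb ja jG (on_star j b).
    rewrite on_sym => uab ua; have [_ _ uE] := on_pos uG ab uab.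
    have := max_ge u uG uab; move: ua uE pmax_a maxE; clear; lia.
- move=> j; have [u /classify] := occ j.
  case=> [[q _ ->]|[c /and3P[ca cb cG] ->]|[c /and3P[ca cb cG] ->]];
    rewrite mnmDE !mulmnE !mnm1E !(eq_sym _ j).
  + by case: (j == a); case: (j == b).
  + case: (eqVneq j a) => //= ja; case: (eqVneq j b) => //= jb.
    by case: (eqVneq j c) => [jc _|//]; rewrite /A jc ca cb cG.
  + case: (eqVneq j a) => //= ja; case: (eqVneq j b) => //= jb.
    by case: (eqVneq j c) => [jc _|//]; rewrite /B jc ca cb cG orbT.
move=> m; split; first exact: classify.
case=> [[q /andP[q1 q2] ->]|[j /and3P[_ _ jG] -> //]|[j /and3P[_ _ jG] -> //]].
have on_min' : on b a umin by rewrite on_sym.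
have on_max' : on b a umax by rewrite on_sym.
have q_in : umin b <= q <= umax b by rewrite q1.
have [u uG [uab ub]] := on_interval ba minG maxG on_min' on_max' q_in.
suff <- : u = (U_(a) *+ (d - q) + U_(b) *+ q)%MM by [].
have [_ _ uE] := on_pos uG ba uab; apply: on_eq uab _ _ _.
- apply/onP => k kb ka; rewrite mnmDE !mulmnE !mnm1E !(eq_sym _ k).
  by rewrite (negbTE ka) (negbTE kb).
- by rewrite mnmDE !mulmnE !mnm1E (negbTE ab) eqxx mul1n.
- rewrite mnmDE !mulmnE !mnm1E (negbTE ba) eqxx mul1n addn0 -uE ub.
  by rewrite addKn.
Qed.

End Combinatorics.

(** * Double stars *)

Section DoubleStarIdeals.
Context {K : fieldType} {n : nat}.
Implicit Types (I : {mpoly K[n]} -> Prop) (a b c o : 'I_n).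

Lemma linres_edge a b d lo k : a != b -> (lo + k <= d.+1)%N ->
  linres (monomial_span (fun m => exists2 q, (lo <= q < lo + k)%N &
    m = (U_(a) *+ (d - q) + U_(b) *+ q)%MM) : {mpoly K[n]} -> Prop) d.
Proof.
move=> ab; elim: k => [_|k IHk lokd].
  apply: eq_linres (linres_zero d) => p; split=> [->|]; first exact: ideal_span0.
  move/monomial_spanP => p0; apply: msuppnil0; case: msupp p0 => // m l /(_ m).
  by rewrite inE eqxx => /(_ isT) [u [q qlo _] _]; move: qlo; clear; lia.
have lokd' : (lo + k <= d)%N by rewrite -ltnS -addnS.
pose u : 'X_{1..n} := (U_(a) *+ (d - (lo + k)) + U_(b) *+ (lo + k))%MM.
have u_deg : mdeg u = d by rewrite mdegD !mdegMn !mdeg1 !mul1n subnK.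
(* The colon ideal is (x_a), except at the first generator, where nothing precedes and it is
   zero. *)
pose T : pred 'I_n := fun i => (i == a) && (0 < k)%N.
apply: eq_linres
  (linres_add_monomial (u := u) (IHk (ltnW _)) u_deg (linres_variables T) _ _).
- move=> p; apply: eq_monomial_span => m; split.
    case=> [[q qk ->]|->]; first by exists q => //; move: qk; clear; lia.
    by exists (lo + k)%N => //; clear; lia.
  case=> q qk ->; have [qE|q_k] := eqVneq q (lo + k)%N; first by right; rewrite qE.
  by left; exists q => //; move: qk q_k; clear; lia.
- by rewrite -addnS.
- move=> _ [q qk ->]; exists a; first by rewrite /T eqxx; move: qk; clear; lia.
  rewrite !mnmDE !mulmnE !mnm1E eqxx eq_sym (negbTE ab).
  by move: qk lokd'; clear; lia.
- move=> _ /andP[/eqP -> k0].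
  exists (U_(a) *+ (d - (lo + k.-1)) + U_(b) *+ (lo + k.-1))%MM.
    by exists (lo + k.-1)%N => //; move: k0; clear; lia.
  apply/mnm_lepP => i; rewrite !mnmDE !mulmnE !mnm1E.
  by move: lokd' k0; clear; case: (a == i); case: (b == i); lia.
Qed.

(** Here c is the center and o the opposite end of the edge. The colon by x_j x_c^(d-1) is generated
    by the leaves already added and by x_o, since x_o divides all of [S] and x_o x_c^(d-1) is in
    [S]. The latter is demanded only in the presence of a leaf, as an edge without star may stop
    earlier. *)
Lemma linres_star (S : 'X_{1..n} -> Prop) o c d (s : seq 'I_n) :
    linres (monomial_span S : {mpoly K[n]} -> Prop) d ->
    (0 < d)%N -> o != c -> uniq s -> {in s, forall j, (j != o) && (j != c)} ->
    (forall v, S v -> (0 < v o)%N) ->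
    ({in s, forall j, S (U_(o) + U_(c) *+ d.-1)%MM}) ->
  linres (monomial_span (mon_union S (fun m => exists2 j, j \in s &
    m = (U_(j) + U_(c) *+ d.-1)%MM)) : {mpoly K[n]} -> Prop) d.
Proof.
move=> linS d0 oc; elim: s => [_ _ _ _|j s IHs /= /andP[j_notin uniq_s] s_in So Soc].
  apply: eq_linres linS => p; apply: eq_monomial_span => m.
  by split=> [|[|[]]] //; left.
have {}IHs := IHs uniq_s _ So _.
have /andP[jo jc] := s_in j (mem_head _ _).
have u_deg : mdeg (U_(j) + U_(c) *+ d.-1 : 'X_{1..n})%MM = d.
  by rewrite mdegD mdegMn !mdeg1 mul1n add1n prednK.
pose T : pred 'I_n := fun i => (i == o) || (i \in s).
apply: eq_linres (linres_add_monomial (IHs _ _) u_deg (linres_variables T) _ _).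
- move=> p; apply: eq_monomial_span => m; split.
    case=> [[Sm|[i i_s ->]]|->]; first by left.
      by right; exists i => //; rewrite inE i_s orbT.
    by right; exists j; rewrite // mem_head.
  case=> [Sm|[i]]; first by left; left.
  by rewrite inE => /orP[/eqP -> ->|i_s ->]; [right|left; right; exists i].
- by move=> i i_s; apply: s_in; rewrite inE i_s orbT.
- by move=> i _; apply: (Soc j); rewrite mem_head.
- move=> v [Sv|[i i_s ->]].
    exists o; first by rewrite /T eqxx.
    by rewrite mnmDE mulmnE !mnm1E (negbTE jo) eq_sym (negbTE oc) So.
  exists i; first by rewrite /T i_s orbT.
  rewrite !mnmDE !mulmnE !mnm1E eqxx.
  by case: (eqVneq j i) j_notin => [->|//]; rewrite i_s.
- move=> i /orP[/eqP ->|i_s].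
    exists (U_(o) + U_(c) *+ d.-1)%MM; first by left; apply: (Soc j); rewrite mem_head.
    by apply/mnm_lepP => l; rewrite !mnmDE; clear; lia.
  exists (U_(i) + U_(c) *+ d.-1)%MM; first by right; exists i.
  by apply/mnm_lepP => l; rewrite !mnmDE; clear; lia.
Qed.

Lemma linres_double_star a b d lo hi (A B : pred 'I_n) :
  double_star_wf a b d lo hi A B ->
  linres (monomial_span (double_star a b d lo hi A B) : {mpoly K[n]} -> Prop) d.
Proof.
case=> ab lo0 lohi hid Aab Bab Alo Bhi.
have d0 : (0 < d)%N by move: hid; clear; lia.
have ba : b != a by rewrite eq_sym.
have d1 : (1 < d)%N by move: lo0 lohi hid; clear; lia.
have k_le : (lo + (hi - lo).+1 <= d.+1)%N by move: lohi hid; clear; lia.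
have inner q : (lo <= q < lo + (hi - lo).+1)%N = (lo <= q <= hi)%N.
  by move: lohi; clear; lia.
have linA := linres_star (o := b) (c := a) (s := enum A) (linres_edge ab k_le) d0 ba
  (enum_uniq _).
(* For the second star the opposite end is a, and x_a divides the edge generators as well as the
   star at a, because d > 1. *)
have linB := linres_star (o := a) (c := b) (s := enum B) (linA _ _ _) d0 ab (enum_uniq _).
apply: eq_linres (linB _ _ _ _ _ _).
- move=> p; apply: eq_monomial_span => m; split.
    case=> [[[q]|[j]]|[j]]; rewrite ?mem_enum => ? ->.
    + by apply: Or31; exists q; rewrite // -inner.
    + by apply: Or32; exists j.
    + by apply: Or33; exists j.
  case=> [[q q_in]|[j j_in]|[j j_in]] ->.
  + by left; left; exists q; rewrite // inner.
  + by left; right; exists j; rewrite ?mem_enum.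
  + by right; exists j; rewrite ?mem_enum.
- by move=> j; rewrite mem_enum => /Aab; rewrite andbC.
- move=> _ [q q_in ->]; rewrite mnmDE !mulmnE !mnm1E (negbTE ab) eqxx mul1n.
  by move: q_in lo0; clear; lia.
- move=> j; rewrite mem_enum => /Alo lo1; exists 1%N; first by rewrite lo1; clear; lia.
  by rewrite mulm1n addmC subn1.
- by move=> j; rewrite mem_enum => /Bab.
- move=> _ [[q q_in ->]|[j _ ->]]; rewrite mnmDE !mulmnE !mnm1E eqxx mul1n.
    by move: q_in hid lohi; clear; lia.
  by move: d1; clear; lia.
- move=> j; rewrite mem_enum => /Bhi hiE; left; exists d.-1.
    by rewrite inner hiE leqnn andbT -hiE ltnW.
  have -> : (d - d.-1 = 1)%N by move: d0; clear; lia.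
  by rewrite mulm1n.
Qed.

Lemma linres_is_double_star I d : support_two I -> non_minimal I ->
    all_variables_occur I -> linres I d ->
  exists a b lo hi (A B : pred 'I_n), [/\ double_star_wf a b d lo hi A B,
    forall j, [|| j == a, j == b, A j | B j] &
    same_ideal I (monomial_span (double_star a b d lo hi A B))].
Proof.
case=> G hG G2 nonmin [G' hG' occ'] linI.
have [_ IG _] := hG.
have linG : linres (monomial_span (fun m => m \in G) : {mpoly K[n]} -> Prop) d.
  exact: eq_linres linI.
have Gdeg := linres_mdeg (mingens_antichain hG) linG.
have exch C w u0 v0 := @linres_connected K n G d C w u0 v0 linG Gdeg.
have occ i : exists2 u, u \in G & (0 < u i)%N.
  by have [u uG' ui] := occ' i; exists u; rewrite // (mingens_eqi hG hG').
have hex a b c : a != b -> a != c -> b != c -> d = 3%N ->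
    (exists2 g, g \in G & (g <= U_(a) + (U_(a) + U_(b) + U_(c)))%MM) ->
    (exists2 g, g \in G & (g <= U_(b) + (U_(a) + U_(b) + U_(c)))%MM) ->
    (exists2 g, g \in G & (g <= U_(c) + (U_(a) + U_(b) + U_(c)))%MM) -> False.
  (* The degree of f equals that of the generators, so in the ideal f would itself be a generator,
     with three variables in its support. *)
  move=> ab ac bc d3; set f := (U_(a) + U_(b) + U_(c))%MM.
  have f_deg : mdeg f = 3%N by rewrite !mdegD !mdeg1.
  have mono x : (exists2 g, g \in G & (g <= U_(x) + f)%MM) ->
      monomial_span (fun m => m \in G) ('X_x * 'X_[f] : {mpoly K[n]}).
    by rewrite -mpolyXD => /monomial_spanX.
  move=> /mono fa /mono fb /mono fc.
  have : monomial_span (fun m => m \in G) ('X_[f] : {mpoly K[n]}).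
    apply: (linres_colon3 (e := 3%N) linG ab ac bc) => //; last 2 first.
    - by rewrite d3.
    - move=> m; rewrite msuppX inE => /eqP ->; apply/forallP => i.
      rewrite !mnmDE !mnm1E /= !(eq_sym i).
      by case: (a == i); case: (b == i); case: (c == i).
    by rewrite dhomogX; apply/eqP.
  case/monomial_spanX => g gG gf.
  have gE : g = f by apply: eq_lem_mdeg => //; rewrite (Gdeg g gG) f_deg.
  have sub : [set a; b; c] \subset supp g.
    apply/subsetP => i; rewrite !inE gE !mnmDE !mnm1E !(eq_sym i).
    by case: (a == i); case: (b == i); case: (c == i).
  have := subset_leq_card sub; rewrite [#|supp g|]G2 // -setUA cardsU1 !inE.
  by rewrite negb_or ab ac cards2 bc.
have [u [v [uG vG uv uvE]]] := non_minimal_same_supp nonmin hG G2.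
have /eqP/cards2P [a [b [ab uE]]] := G2 u uG.
have on_u : on a b u.
  apply/onP => k ka kb; apply/eqP; rewrite -leqn0 leqNgt.
  have : k \notin supp u by rewrite /supp uE !inE negb_or ka kb.
  by rewrite inE.
have on_v : on a b v.
  apply/onP => k ka kb; apply/eqP; rewrite -leqn0 leqNgt.
  have : k \notin supp v by rewrite -uvE /supp uE !inE negb_or ka kb.
  by rewrite inE.
have [_ _ ud] := on_pos Gdeg G2 uG ab on_u.
have [_ _ vd] := on_pos Gdeg G2 vG ab on_v.
have [u1 [u2 [u1G u2G on1 [on2 lt12]]]] : exists u1 u2,
    [/\ u1 \in G, u2 \in G, on a b u1 & on a b u2 /\ (u1 a < u2 a)%N].
  case: (ltngtP (u a) (v a)) => [lt|lt|eq_a]; [by exists u, v|by exists v, u|].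
  have eq_b : u b = v b by move: ud vd eq_a; clear; lia.
  by case/eqP: uv; apply: on_eq on_u on_v eq_a eq_b.
have [lo [hi [A [B [wf cover mem]]]]] :=
  double_star_generators Gdeg G2 exch hex ab u1G u2G on1 on2 lt12 occ.
exists a, b, lo, hi, A, B; split=> // p; rewrite IG.
exact: eq_monomial_span.
Qed.

End DoubleStarIdeals.

(** * The six families *)

Section Permutations.
Context {K : fieldType} {n : nat}.
Implicit Types (I J : {mpoly K[n]} -> Prop) (a b : 'I_n) (A B : pred 'I_n).
Implicit Types (m : 'X_{1..n}) (s : 'S_n).

Local Notation "m # s" := [multinom m (s i) | i < n]
  (at level 40, left associativity).

Lemma permute_monomial_span s (M : 'X_{1..n} -> Prop) :
  same_ideal (permute_ideal s (monomial_span M : {mpoly K[n]} -> Prop))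
    (monomial_span (fun m => M (m#(s^-1)%g))).
Proof.
move=> p; rewrite /permute_ideal !monomial_spanP; split=> Mp m m_in.
  have [|u Mu /mnm_lepP um] := Mp (m#(s^-1)%g).
    by rewrite mcoeff_msupp mcoeff_sym mpermK -mcoeff_msupp.
  exists (u#s); rewrite ?mpermKV //; apply/mnm_lepP => i.
  by have := um (s i); rewrite !mnmE permK.
have [|u Mu /mnm_lepP um] := Mp (m#s).
  by rewrite mcoeff_msupp -mcoeff_sym -mcoeff_msupp.
exists (u#(s^-1)%g) => //; apply/mnm_lepP => i.
by have := um (s^-1 i)%g; rewrite !mnmE permKV.
Qed.

Lemma double_star_perm s a b d lo hi A B m :
  double_star (s a) (s b) d lo hi A B (m#(s^-1)%g) <->
  double_star a b d lo hi (fun i => A (s i)) (fun i => B (s i)) m.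
Proof.
have U_s i : U_(s i)%MM#s = U_(i)%MM.
  by apply/mnmP => k; rewrite mnmE !mnm1E (inj_eq perm_inj).
have Mn u k : (u *+ k)%MM#s = ((u#s) *+ k)%MM.
  by apply/mnmP => i; rewrite mnmE !mulmnE mnmE.
have D u v : (u + v)%MM#s = (u#s + v#s)%MM.
  by apply/mnmP => i; rewrite mnmE !mnmDE !mnmE.
split.
  case=> [[q q_in]|[j j_in]|[j j_in]] /(congr1 (fun u : 'X_{1..n} => u#s));
    rewrite mpermK D !Mn ?U_s => ->.
  - by apply: Or31; exists q.
  - by apply: Or32; exists (s^-1 j)%g; rewrite ?permKV // -{1}[j](permKV s) U_s.
  - by apply: Or33; exists (s^-1 j)%g; rewrite ?permKV // -{1}[j](permKV s) U_s.
case=> [[q q_in]|[j j_in]|[j j_in]] mE.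
- by apply: Or31; exists q; rewrite // -[RHS](mpermKV s) D !Mn !U_s -mE.
- by apply: Or32; exists (s j); rewrite // -[RHS](mpermKV s) D !Mn !U_s -mE.
- by apply: Or33; exists (s j); rewrite // -[RHS](mpermKV s) D !Mn !U_s -mE.
Qed.

Lemma permute_double_star s a b d lo hi A B I :
    same_ideal I (monomial_span (double_star (s a) (s b) d lo hi A B)) ->
  same_ideal (permute_ideal s I) (monomial_span
    (double_star a b d lo hi (fun i => A (s i)) (fun i => B (s i)))).
Proof.
move=> IM p; rewrite /permute_ideal IM.
rewrite -[monomial_span _ _]/(permute_ideal s (monomial_span _) p).
rewrite (permute_monomial_span s _ p); apply: eq_monomial_span => m.
exact: double_star_perm.
Qed.

Lemma permute_idealK s I p : permute_ideal (s^-1)%g (permute_ideal s I) p <-> I p.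
Proof. by rewrite /permute_ideal -msymMm mulVg msym1m. Qed.

Lemma permute_double_starV s a b d lo hi A B I :
    same_ideal (permute_ideal s I) (monomial_span (double_star a b d lo hi A B)) ->
  same_ideal I (monomial_span (double_star (s a) (s b) d lo hi
    (fun i => A ((s^-1)%g i)) (fun i => B ((s^-1)%g i)))).
Proof.
rewrite -{1}[a](permK s) -{1}[b](permK s) => sI p.
by rewrite -(permute_idealK s); apply: (permute_double_star sI).
Qed.

Lemma double_star_wf_perm s a b d lo hi A B : double_star_wf a b d lo hi A B ->
  double_star_wf (s a) (s b) d lo hi (fun i => A ((s^-1)%g i)) (fun i => B ((s^-1)%g i)).
Proof.
case=> ab lo0 lohi hid Aab Bab Alo Bhi.
have inv j c : ((s^-1)%g j != c) = (j != s c).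
  by rewrite -(inj_eq (@perm_inj _ s)) permKV.
split=> [||||j /Aab|j /Bab|j /Alo|j /Bhi]; rewrite ?inv ?(inj_eq (@perm_inj _ s)) //.
Qed.

(** The edge is parametrized by the exponent q of its second end, so exchanging the ends reflects q
    to d - q. *)
Lemma double_star_wf_swap a b d lo hi A B : double_star_wf a b d lo hi A B ->
  double_star_wf b a d (d - hi) (d - lo) B A.
Proof.
case=> ab lo0 lohi hid Aab Bab Alo Bhi.
split; rewrite ?[b == a]eq_sym //; try by move: lo0 lohi hid; clear; lia.
- by move=> j /Bab; rewrite andbC.
- by move=> j /Aab; rewrite andbC.
- by move=> j /Bhi; move: lo0 lohi hid; clear; lia.
- by move=> j /Alo; move: lo0 lohi hid; clear; lia.
Qed.

Lemma double_star_swap a b d lo hi A B m : (lo <= d)%N -> (hi <= d)%N ->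
  double_star a b d lo hi A B m -> double_star b a d (d - hi) (d - lo) B A m.
Proof.
move=> lod hid [[q q_in ->]|[j j_in ->]|[j j_in ->]].
- apply: Or31; exists (d - q)%N; first by move: q_in lod hid; clear; lia.
  by rewrite addmC; congr (_ *+ _ + _)%MM; move: q_in hid; clear; lia.
- by apply: Or33; exists j.
- by apply: Or32; exists j.
Qed.

End Permutations.

(** * The families as double stars in sorted variables *)

Section Families.
Context {n : nat}.
Implicit Types (m w : 'X_{1..n}).

Lemma xvarE (i : 'I_n) j : i.+1 = j -> xvar j = U_(i)%MM.
Proof.
by move=> <-; apply/mnmP => k; rewrite mnmE mnm1E eqSS eq_sym.
Qed.

Lemma shifted_powersE (i0 i1 : 'I_n) a b k m : i0 = 0%N :> nat -> i1 = 1%N :> nat ->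
  shifted_powers a b k m <-> exists2 q, (b <= q <= b + k)%N &
    m = (U_(i0) *+ (a + b - q) + U_(i1) *+ q)%MM.
Proof.
move=> e0 e1; rewrite /shifted_powers (@xvarE i0) ?e0 // (@xvarE i1) ?e1 //.
split=> [[i ik ->]|[q q_in ->]].
  exists (b + i)%N; first by move: ik; clear; lia.
  by congr (_ *+ _ + _)%MM; clear; lia.
exists (q - b)%N; first by move: q_in; clear; lia.
by congr (_ *+ _ + _ *+ _)%MM; move: q_in; clear; lia.
Qed.

Lemma inner_powersE (i0 i1 : 'I_n) k m : i0 = 0%N :> nat -> i1 = 1%N :> nat ->
  inner_powers k m <-> exists2 q, (1 <= q <= k)%N &
    m = (U_(i0) *+ (k.+1 - q) + U_(i1) *+ q)%MM.
Proof.
by move=> e0 e1; rewrite /inner_powers (@xvarE i0) ?e0 // (@xvarE i1) ?e1 // addn1.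
Qed.

Lemma starE w lo hi m : (0 < lo)%N -> (hi <= n)%N ->
  star w lo hi m <-> exists2 i : 'I_n, (lo <= i.+1 <= hi)%N & m = (U_(i) + w)%MM.
Proof.
move=> lo0 hin; split=> [[j j_in ->]|[i i_in ->]]; last first.
  by exists i.+1 => //; rewrite (xvarE (erefl i.+1)).
have jn : (j.-1 < n)%N by move: j_in lo0 hin; clear; lia.
have jE : (Ordinal jn).+1 = j by rewrite /= prednK //; move: j_in lo0; clear; lia.
by exists (Ordinal jn); [rewrite jE | rewrite (xvarE jE)].
Qed.

(** A common form of the last four families: p = s gives (3), p = 2 and s = n give (4), s = n gives
    (5), and p < s < n gives (6). The bounds shift by one because ['I_n] counts from 0 and [xvar]
    from 1. *)
Lemma two_starsE (i0 i1 : 'I_n) k s p m :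
    i0 = 0%N :> nat -> i1 = 1%N :> nat -> (s <= n)%N ->
  mon_union (inner_powers k) (mon_union (star (xvar 1 *+ k) 3 s)
    (star (xvar 2 *+ k) (p + 1) n)) m <->
  double_star i0 i1 k.+1 1 k (fun i => 2 <= i < s)%N (fun i => p <= i)%N m.
Proof.
move=> e0 e1 sn; rewrite /mon_union (inner_powersE _ _ e0 e1) !starE ?addn1 //.
rewrite (@xvarE i0) ?e0 // (@xvarE i1) ?e1 //.
split=> [[[q q_in ->]|[[i i_in ->]|[i i_in ->]]]|[[q q_in ->]|[i i_in ->]|[i i_in ->]]].
- by apply: Or31; exists q.
- by apply: Or32; exists i.
- by apply: Or33; exists i => //; case/andP: i_in.
- by left; exists q.
- by right; left; exists i.
- by right; right; exists i => //; rewrite ltnS i_in /=.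
Qed.

Lemma one_starE (i0 i1 : 'I_n) b k m : i0 = 0%N :> nat -> i1 = 1%N :> nat ->
  mon_union (shifted_powers (k + 1) b k) (star (xvar 2 *+ (b + k)) 3 n) m <->
  double_star i0 i1 (b + k).+1 b (b + k) pred0 (fun i => 2 <= i)%N m.
Proof.
move=> e0 e1; rewrite /mon_union (shifted_powersE _ _ _ _ e0 e1) starE //.
rewrite (@xvarE i1) ?e1 // (_ : (k + 1 + b = (b + k).+1)%N); last by clear; lia.
split=> [[[q q_in ->]|[i i_in ->]]|[[q q_in ->]|[i //]|[i i_in ->]]].
- by apply: Or31; exists q.
- by apply: Or33; exists i => //; case/andP: i_in.
- by left; exists q.
- by right; exists i => //; rewrite ltnS i_in /=.
Qed.

End Families.

(** Listing the variables as a, b, A \ B, A meet B, B \ A makes A and B intervals overlapping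
    exactly in their intersection, which is the shape of the families. *)
Lemma sorting_perm n (a b : 'I_n) (A B : pred 'I_n) (x := #|predD A B|)
    (y := #|predI A B|) (z := #|predD B A|) : a != b ->
    (forall j, A j -> (j != a) && (j != b)) ->
    (forall j, B j -> (j != a) && (j != b)) ->
    (forall j, [|| j == a, j == b, A j | B j]) ->
  n = (2 + x + y + z)%N /\ exists s : 'S_n, forall i : 'I_n,
    [/\ i = 0%N :> nat -> s i = a, i = 1%N :> nat -> s i = b,
        A (s i) = (2 <= i < 2 + x + y)%N & B (s i) = (2 + x <= i)%N].
Proof.
move=> ab Aab Bab cover.
pose L := [:: a; b] ++ enum (predD A B) ++ enum (predI A B) ++ enum (predD B A).
have L_size : size L = (2 + x + y + z)%N by rewrite !size_cat -!cardE !addnA.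
have L_all j : j \in L.
  rewrite !mem_cat !mem_enum !inE; have := cover j.
  by rewrite /=; case: (j == a); case: (j == b); case: (A j); case: (B j).
have notA j : (j == a) || (j == b) -> A j = false.
  by move=> jab; apply/negbTE; apply: contraL jab => /Aab; rewrite negb_or.
have notB j : (j == a) || (j == b) -> B j = false.
  by move=> jab; apply/negbTE; apply: contraL jab => /Bab; rewrite negb_or.
have L_uniq : uniq L.
  rewrite !cat_uniq !enum_uniq /= !inE ab /= !andbT.
  apply/and3P; split; apply/hasPn => j; rewrite ?mem_cat !mem_enum !inE /=.
  - apply: contraL => jab.
    by rewrite notA ?notB // !inE.
  - by case: (A j); case: (B j).
  - by case: (A j); case: (B j).
have nE : size L = n.
  rewrite -[RHS]card_ord cardE; apply/perm_size/uniq_perm; rewrite ?enum_uniq //.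
  by move=> j; rewrite L_all mem_enum.
split; first by rewrite -nE.
have inj : injective (fun i : 'I_n => nth a L i).
  by move=> i j /eqP; rewrite nth_uniq ?nE // => /eqP/ord_inj.
exists (perm inj) => i; rewrite permE.
suff [AE BE] : A (nth a L i) = (2 <= i < 2 + x + y)%N /\ B (nth a L i) = (2 + x <= i)%N.
  by split=> // ->.
have i_lt : (i < 2 + x + y + z)%N by rewrite -L_size nE.
rewrite /L nth_cat; case: ltnP => [i2|i2].
  have -> : (2 + x <= i)%N = false by rewrite leqNgt (leq_trans i2) ?leq_addr.
  have : nth a [:: a; b] i \in [:: a; b] by apply: mem_nth.
  by rewrite !inE => ab_i; rewrite notA ?notB.
have nth_in (P : pred 'I_n) k : (k < #|P|)%N -> P (nth a (enum P) k).
  by rewrite cardE => /(mem_nth a); rewrite mem_enum.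
rewrite nth_cat -cardE -/x; case: ltnP => [ix|ix].
  have /andP[/negbTE -> Ai] := nth_in _ _ ix; rewrite [A _]Ai.
  by move: i2 ix => /=; clear; lia.
rewrite nth_cat -cardE -/y; case: ltnP => [iy|iy].
  have /andP[Ai Bi] := nth_in _ _ iy; rewrite [A _]Ai [B _]Bi.
  by move: i2 ix iy => /=; clear; lia.
have iz : (i - size [:: a; b] - x - y < z)%N by move: i_lt i2 ix iy => /=; clear; lia.
have /andP[/negbTE -> Bi] := nth_in _ _ iz; rewrite [B _]Bi.
by move: i2 ix iy => /=; clear; lia.
Qed.

(** * Matching double stars with the six families *)

Section Classification.
Context {K : fieldType} {n : nat}.
Implicit Types (I J : {mpoly K[n]} -> Prop).

Lemma two_stars_wf (i0 i1 : 'I_n) k s p : i0 = 0%N :> nat -> i1 = 1%N :> nat ->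
  (2 <= k)%N -> (2 <= p)%N ->
  double_star_wf i0 i1 k.+1 1 k (fun i => 2 <= i < s)%N (fun i => p <= i)%N.
Proof.
move=> e0 e1 k2 p2; split=> //.
- by rewrite -val_eqE /= e0 e1.
- by move=> j /andP[j2 _]; rewrite -!val_eqE /= e0 e1; move: j2; clear; lia.
- by move=> j pj; rewrite -!val_eqE /= e0 e1; move: p2 pj; clear; lia.
Qed.

Lemma cases_double_star J :
    case1 J \/ case2 J \/ case3 J \/ case4 J \/ case5 J \/ case6 J ->
  exists a b d lo hi (A B : pred 'I_n), double_star_wf a b d lo hi A B /\
    same_ideal J (monomial_span (double_star a b d lo hi A B)).
Proof.
move=> cases.
have n2 : (1 < n)%N.
  case: cases => [[n_2 _]|[[n3 _]|[[k [s [_ s3 sn _]]]|[[n3 _]|[[k [p [_ p3 pn _]]]|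
    [k [p [s [_ p3 ps sn _]]]]]]]]].
  - by rewrite n_2.
  - exact: ltnW.
  - by move: s3 sn; clear; lia.
  - exact: ltnW.
  - by move: p3 pn; clear; lia.
  - by move: p3 ps sn; clear; lia.
pose i0 : 'I_n := Ordinal (ltnW n2); pose i1 : 'I_n := Ordinal n2.
have two_stars k s p : (2 <= k)%N -> (2 <= p)%N -> (s <= n)%N ->
    same_ideal J (monomial_span (mon_union (inner_powers k) (mon_union
      (star (xvar 1 *+ k)%MM 3 s) (star (xvar 2 *+ k)%MM (p + 1) n)))) ->
    exists a b d lo hi (A B : pred 'I_n), double_star_wf a b d lo hi A B /\
      same_ideal J (monomial_span (double_star a b d lo hi A B)).
  move=> k2 p2 sn JE; exists i0, i1, k.+1, 1%N, k.
  exists (fun i => 2 <= i < s)%N, (fun i => p <= i)%N.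
  split; first exact: two_stars_wf.
  by move=> q; rewrite JE; apply: eq_monomial_span => m; apply: two_starsE.
have i01 : i0 != i1 by [].
case: cases => [|[|[|[|[]]]]].
- case=> n_2 [k [a [b [k1 ka b1 JE]]]].
  exists i0, i1, (a + b)%N, b, (b + k)%N, pred0, pred0; split.
    by split=> //; move: k1 ka; clear; lia.
  move=> q; rewrite JE; apply: eq_monomial_span => m.
  rewrite (@shifted_powersE _ i0 i1) //; split; first by move=> ?; apply: Or31.
  by case=> // -[].
- case=> n3 [k [_ [b [k1 b1 -> JE]]]].
  exists i0, i1, (b + k).+1, b, (b + k)%N, pred0, (fun i => 2 <= i)%N; split.
    split=> //; first by move: k1; clear; lia.
    by move=> j j2; rewrite -!val_eqE /=; move: j2; clear; lia.
  by move=> q; rewrite JE; apply: eq_monomial_span => m; apply: one_starE.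
- case=> k [s [k2 s3 sn JE]]; apply: (two_stars k s s) => //; [exact: ltnW|exact: ltnW].
- by case=> n3 [k k2 JE]; apply: (two_stars k n 2).
- by case=> k [p [k2 p3 pn JE]]; apply: (two_stars k n p) => //; apply: ltnW.
- by case=> k [p [s [k2 p3 ps sn JE]]]; apply: (two_stars k s p) => //; apply: ltnW.
Qed.

(* The hypotheses on the cards discard the two patterns of stars which the
   families only contain after exchanging the two centers. *)
Lemma double_star_cases a b d lo hi (A B : pred 'I_n) I :
    double_star_wf a b d lo hi A B ->
    (forall j, [|| j == a, j == b, A j | B j]) ->
    same_ideal I (monomial_span (double_star a b d lo hi A B)) ->
    (#|predI A B| = 0 -> #|predD B A| = 0 -> #|predD A B| = 0)%N ->
    (#|predD A B| = 0 -> #|predI A B| = 0 \/ #|predD B A| = 0)%N ->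
  exists s : 'S_n, let J := permute_ideal s I in
    case1 J \/ case2 J \/ case3 J \/ case4 J \/ case5 J \/ case6 J.
Proof.
case=> ab lo0 lohi hid Aab Bab Alo Bhi cover IE.
have [] := sorting_perm ab Aab Bab cover.
set x := #|predD A B|; set y := #|predI A B|; set z := #|predD B A|.
move=> nE [s sE] h1 h2; exists s => /=.
have n2 : (1 < n)%N by move: nE; clear; lia.
pose i0 : 'I_n := Ordinal (ltnW n2); pose i1 : 'I_n := Ordinal n2.
have [/(_ erefl) s0 _ _ _] := sE i0; have [_ /(_ erefl) s1 _ _] := sE i1.
have IJ := @permute_double_star K n s i0 i1 d lo hi A B I.
rewrite s0 s1 in IJ; have {IE}IJ := IJ IE.
have {}IJ : same_ideal (permute_ideal s I) (monomial_span (double_star i0 i1 d lo hi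
    (fun i => 2 <= i < 2 + x + y)%N (fun i => 2 + x <= i)%N)).
  move=> p; rewrite IJ; apply: eq_monomial_span => m; rewrite /double_star.
  by split; (case=> [h|[j]|[j]]; [exact: Or31| |];
    have [_ _ AE BE] := sE j => j_in ->; [apply: Or32|apply: Or33]; exists j => //;
    move: j_in; rewrite ?AE ?BE).
have lo1 : (0 < x + y)%N -> lo = 1%N.
  rewrite addn_gt0 => /orP[] /card_gt0P [j]; rewrite !inE => /andP[].
    by move=> _ /Alo.
  by move=> /Alo.
have hi1 : (0 < y + z)%N -> hi = d.-1.
  rewrite addn_gt0 => /orP[] /card_gt0P [j]; rewrite !inE => /andP[].
    by move=> _ /Bhi.
  by move=> _ /Bhi.
have two_stars s' p' : (0 < x + y)%N -> (0 < y + z)%N -> (s' = 2 + x + y)%N ->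
    (p' = 2 + x)%N ->
    same_ideal (permute_ideal s I) (monomial_span (mon_union (inner_powers d.-1)
      (mon_union (star (xvar 1 *+ d.-1)%MM 3 s') (star (xvar 2 *+ d.-1)%MM (p' + 1) n)))).
  move=> /lo1 loE /hi1 hiE s'E p'E p; rewrite IJ; apply: eq_monomial_span => m.
  rewrite (@two_starsE _ i0 i1) //; last by rewrite s'E nE leq_addr.
  by rewrite loE hiE s'E p'E prednK //; move: hid; clear; lia.
have k2 : (0 < x + y)%N -> (0 < y + z)%N -> (2 <= d.-1)%N.
  by move=> /lo1 loE /hi1 hiE; move: lohi; rewrite loE hiE.
(* Without leaves at a, the ideal is in case 1 or 2 according to whether b has leaves. Otherwise
   both ends have leaves, and the order of the tests is: disjoint stars (3), equal stars (4), B
   strictly inside A (5), proper overlap (6). *)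
have [xy0|xy0] := posnP (x + y)%N.
  have [x0 y0] : x = 0%N /\ y = 0%N by move: xy0; clear; lia.
  have [z0|z0] := posnP z.
    left; split; first by rewrite nE x0 y0 z0.
    exists (hi - lo)%N, (d - lo)%N, lo; split=> //; try by move: lohi hid; clear; lia.
    move=> p; rewrite IJ; apply: eq_monomial_span => m.
    rewrite (@shifted_powersE _ i0 i1) // subnK ?subnKC 1?ltnW // ?(ltn_trans lohi) //.
    split; last by move=> ?; apply: Or31.
    case=> // -[j j_in _]; move: j_in; have := ltn_ord j; rewrite {2}nE x0 y0 z0;
      by clear; lia.
  right; left; split; first by move: nE z0; clear; lia.
  have hiE : hi = d.-1 by apply: hi1; rewrite addn_gt0 z0 orbT.
  exists (hi - lo)%N, (hi - lo + 1)%N, lo; split=> //; first by rewrite subn_gt0.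
  move=> p; rewrite IJ; apply: eq_monomial_span => m.
  rewrite (@one_starE _ i0 i1) // subnKC 1?ltnW // x0 y0.
  rewrite {2}hiE prednK; last by move: hid; clear; lia.
  by split; (case=> [h|[j]|h]; [exact: Or31| |exact: Or33]) => //;
    move=> /andP[]; clear; lia.
have yz0 : (0 < y + z)%N.
  rewrite lt0n addn_eq0; apply/negP => /andP[/eqP y0 /eqP z0].
  by move: xy0; rewrite h1 // y0.
have {}two_stars s' p' := two_stars s' p' xy0 yz0; have {}k2 := k2 xy0 yz0.
have [y0|y0] := posnP y.
  do 2!right; left; exists d.-1, (2 + x)%N; split=> //;
    try by move: xy0 yz0 nE; rewrite y0; clear; lia.
  by apply: two_stars; rewrite // y0 addn0.
have [x0|x0] := posnP x.
  have z0 : z = 0%N by case: (h2 x0) => // yE; rewrite yE in y0.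
  do 3!right; left; split; first by move: nE y0; clear; lia.
  exists d.-1 => //; apply: (two_stars n 2%N); first by rewrite nE z0 addn0.
  by rewrite x0.
have [z0|z0] := posnP z.
  do 4!right; left; exists d.-1, (2 + x)%N; split=> //; try by move: nE x0 y0; clear; lia.
  by apply: two_stars; rewrite // nE z0 addn0.
do 5!right; exists d.-1, (2 + x)%N, (2 + x + y)%N.
split; rewrite -?andP //; try by move: nE x0 y0 z0; clear; lia.
exact: two_stars.
Qed.

End Classification.

Theorem theorem5p10 (K : fieldType) (n : nat) (I : {mpoly K[n]} -> Prop)
    (hsupp : support_two I) (hnonmin : non_minimal I)
    (hvars : all_variables_occur I) :
  has_linear_resolution I <->
  exists s : 'S_n,
    case1 (permute_ideal s I) \/ case2 (permute_ideal s I) \/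
    case3 (permute_ideal s I) \/ case4 (permute_ideal s I) \/
    case5 (permute_ideal s I) \/ case6 (permute_ideal s I).
Proof.
split.
  case/has_linear_resolution_linres => d linI.
  have [a [b [lo [hi [A [B [wf cover IE]]]]]]] :=
    linres_is_double_star hsupp hnonmin hvars linI.
  (* The two patterns that need an exchange of ends: leaves only at a, and leaves at a forming a
     nonempty proper subset of those at b. *)
  pose swap := ((#|predI A B| == 0) && (#|predD B A| == 0) && (0 < #|predD A B|) ||
    (#|predD A B| == 0) && (0 < #|predI A B|) && (0 < #|predD B A|))%N.
  have [sw|nsw] := boolP swap; last first.
    by apply: (double_star_cases wf cover IE); move: nsw; rewrite /swap; clear; lia.
  have AB : #|predI A B| = #|predI B A|.
    by apply: eq_card => j; rewrite !inE andbC.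
  apply: (double_star_cases (double_star_wf_swap wf)).
  - by move=> j; rewrite orbCA [B j || _]orbC.
  - move=> p; rewrite IE; apply: eq_monomial_span => m.
    case: (wf) => _ _ lohi hid _ _ _ _.
    have lod : (lo <= d)%N by move: lohi hid; clear; lia.
    split; first by apply: double_star_swap => //; apply: ltnW.
    (* Reflecting twice restores the bounds, so the same inclusion also gives the converse. *)
    rewrite -{2}(subKn lod) -{2}(subKn (ltnW hid)).
    by apply: double_star_swap; apply: leq_subr.
  - by move: sw; rewrite /swap AB; clear; lia.
  - by move: sw; rewrite /swap AB; clear; lia.
case=> s /cases_double_star [a [b [d [lo [hi [A [B [wf IE]]]]]]]].
have /(linres_double_star (K := K)) linM := double_star_wf_perm s wf.
have {}IE := permute_double_starV IE.
apply: (linres_has_linear_resolution (d := d)).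
  by apply: eq_linres linM => p; rewrite IE.
(* It remains to see that I is nonzero: by non-minimality it has at least one generator. *)
have [G hG _] := hsupp; have [k [l [[G' hG' sG'] _ lk]]] := hnonmin.
have [u uG] : exists u, u \in G.
  have := mingens_size hG hG'; case: (G) => [|u G0 _]; last by exists u; rewrite mem_head.
  by move=> /= s0; move: lk; rewrite -sG' -s0.
exists 'X_[u]; first exact: mingens_mem hG uG.
by rewrite -msize_poly_eq0 msizeX.
Qed.
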